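(* Let $u=(u_0,u_1,u_2)\in L_2^{n_0}[x,y]\times H_1^{n_1}[x,y]\times H_2^{n_2}[x,y]$ on $[a,b]\times[c,d]$. Then $$u=\mathcal K_1\Lambda_{\mathrm{bc}}u+\mathcal K_2\hat u,\qquad \hat u=\mathcal Du,$$ where $\mathcal D$, $\Lambda_{\mathrm{bc}}$, $\mathcal K_1$, $\mathcal K_2$ are the operators defined in the context.
   Context: $a<b$, $c<d$. $H_k^m[x,y]=\{u:\partial_x^{\alpha_1}\partial_y^{\alpha_2}u\in L_2^m([a,b]\times[c,d])\ \forall\,\max(\alpha_1,\alpha_2)\le k\}$ (weak derivatives; point values and restrictions to lines $x=a$, $y=c$ are understood in the trace sense/continuous representative). $\mathcal Du=(u_0,\ \partial_x\partial_yu_1,\ \partial_x^2\partial_y^2u_2)$. $\Lambda_{\mathrm{bc}}u=(v_0,v_1,v_2)\in\mathbb R^{n_1+4n_2}\times L_2^{n_1+2n_2}[a,b]\times L_2^{n_1+2n_2}[c,d]$ with $v_0=(u_1(a,c),\,u_2(a,c),\,\partial_xu_2(a,c),\,\partial_yu_2(a,c),\,\partial_x\partial_yu_2(a,c))$, $v_1(x)=(\partial_xu_1(x,c),\,\partial_x^2u_2(x,c),\,\partial_x^2\partial_yu_2(x,c))$, $v_2(y)=(\partial_yu_1(a,y),\,\partial_y^2u_2(a,y),\,\partial_x\partial_y^2u_2(a,y))$. $(\mathcal K_1(v_0,v_1,v_2))(x,y)=K_{30}(x,y)v_0+\int_a^xK_{31}(x,y,\theta)v_1(\theta)d\theta+\int_c^yK_{32}(x,y,\nu)v_2(\nu)d\nu$,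 $(\mathcal K_2\hat u)(x,y)=T_{00}\hat u(x,y)+\int_a^x\int_c^yK_{33}(x,y,\theta,\nu)\hat u(\theta,\nu)d\nu d\theta$, with block rows of sizes $n_0,n_1,n_2$ and (scalars in the last block row multiply $I_{n_2}$) $$K_{30}=\begin{bmatrix}0&0&0&0&0\\ I_{n_1}&0&0&0&0\\0&I_{n_2}&(x-a)&(y-c)&(y-c)(x-a)\end{bmatrix},\quad K_{31}=\begin{bmatrix}0&0&0\\ I_{n_1}&0&0\\0&(x-\theta)&(y-c)(x-\theta)\end{bmatrix},$$ $$K_{32}=\begin{bmatrix}0&0&0\\ I_{n_1}&0&0\\0&(y-\nu)&(x-a)(y-\nu)\end{bmatrix},\quad K_{33}=\begin{bmatrix}0&0&0\\0&I_{n_1}&0\\0&0&(x-\theta)(y-\nu)\end{bmatrix},\quad T_{00}=\begin{bmatrix}I_{n_0}&0&0\\0&0&0\\0&0&0\end{bmatrix}.$$ *)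

(* Defs.v *)
From HB Require Import structures.
From mathcomp Require Import all_boot all_order all_algebra.
From mathcomp Require Import all_classical all_reals all_analysis.

Set Implicit Arguments.
Unset Strict Implicit.
Unset Printing Implicit Defensive.

Import Order.TTheory GRing.Theory Num.Theory.
Import numFieldNormedType.Exports.

Local Open Scope classical_set_scope.
Local Open Scope ring_scope.

Notation leb := lebesgue_measure.
Notation leb2 := (lebesgue_measure \x lebesgue_measure)%E.

Definition rect {R : realType} (a b c d : R) : set (R * R) :=
  `[a, b]%classic `*` `[c, d]%classic.

Definition orect {R : realType} (a b c d : R) : set (R * R) :=
  `]a, b[%classic `*` `]c, d[%classic.

(* Functions are total; only their values on the interval or rectangle matter
   (f \_ D is f on D and 0 outside D). Measurability is Borel measurability. *)

Definition L2itv {R : realType} (a b : R) (f : R -> R) : Prop :=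
  f \_ `[a, b] \in Lfun leb 2%:E.

Definition L2rect {R : realType} (a b c d : R) (f : R * R -> R) : Prop :=
  f \_ (rect a b c d) \in Lfun leb2 2%:E.

(* Classical partial derivatives, used on test functions only. *)
Definition pdx {R : realType} (f : R * R -> R) : R * R -> R :=
  fun z => 'D_((1, 0) : R * R) f z.

Definition pdy {R : realType} (f : R * R -> R) : R * R -> R :=
  fun z => 'D_((0, 1) : R * R) f z.

Fixpoint is_Ck {R : realType} (k : nat) (f : R * R -> R) : Prop :=
  continuous f /\
  if k is k'.+1 then
    [/\ forall z, derivable f z ((1, 0) : R * R),
        forall z, derivable f z ((0, 1) : R * R),
        is_Ck k' (pdx f) & is_Ck k' (pdy f)]
  else True.

Definition test_function {R : realType} (a b c d : R) (phi : R * R -> R) :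
    Prop :=
  [/\ forall k, is_Ck k phi,
      compact (closure [set z | phi z != 0]) &
      closure [set z | phi z != 0] `<=` orect a b c d].

(* g = \partial_x^i \partial_y^j f weakly; the equation is meant for f and g in
   L_2 of the rectangle, so that both integrands are integrable. *)
Definition is_weak_deriv {R : realType} (a b c d : R) (i j : nat)
    (f g : R * R -> R) : Prop :=
  forall phi, test_function a b c d phi ->
    \int[leb2]_(z in rect a b c d) (f z * iter i pdx (iter j pdy phi) z) =
    (-1) ^+ (i + j) * \int[leb2]_(z in rect a b c d) (g z * phi z).

(* A chosen L_2 representative of the weak derivative
   \partial_x^i \partial_y^j f, which is unique up to a null set (0 if f has no
   such derivative in L_2). *)
Definition wderiv {R : realType} (a b c d : R) (i j : nat)
    (f : R * R -> R) : R * R -> R :=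
  xget (fun=> 0)
    [set g | L2rect a b c d g /\ is_weak_deriv a b c d i j f g].

Definition Hspace {R : realType} (a b c d : R) (k : nat)
    (f : R * R -> R) : Prop :=
  L2rect a b c d f /\
  forall i j, (maxn i j <= k)%N ->
    exists2 g, L2rect a b c d g & is_weak_deriv a b c d i j f g.

(* The value of f at (a,c): the value there of the representative of f that is
   continuous on the closed rectangle (0 if there is none). *)
Definition corner_value {R : realType} (a b c d : R) (f : R * R -> R) : R :=
  xget 0 [set p | exists h : R * R -> R,
    [/\ h = f %[ae leb2 in rect a b c d],
        {within rect a b c d, continuous h} & h (a, c) = p]].

(* The restriction x |-> f(x,c): the trace in L_2[a,b], taken along a
   representative of f that is continuous in y on [c,d] for almost every x; it
   is unique up to a null set (0 if there is none). *)
Definition trace_y {R : realType} (a b c d : R) (f : R * R -> R) : R -> R :=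
  xget (fun=> 0) [set g | L2itv a b g /\
    exists h : R * R -> R,
      h = f %[ae leb2 in rect a b c d] /\
      \forall x \ae leb, x \in `[a, b] ->
        {within `[c, d], continuous (fun y => h (x, y))} /\ h (x, c) = g x].

(* The restriction y |-> f(a,y), likewise. *)
Definition trace_x {R : realType} (a b c d : R) (f : R * R -> R) : R -> R :=
  xget (fun=> 0) [set g | L2itv c d g /\
    exists h : R * R -> R,
      h = f %[ae leb2 in rect a b c d] /\
      \forall y \ae leb, y \in `[c, d] ->
        {within `[a, b], continuous (fun x => h (x, y))} /\ h (a, y) = g y].

Definition L2rectv {R : realType} (a b c d : R) (m : nat)
    (f : R * R -> 'cV[R]_m) : Prop :=
  forall l, L2rect a b c d (fun z => f z l 0).

Definition Hspacev {R : realType} (a b c d : R) (k m : nat)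
    (f : R * R -> 'cV[R]_m) : Prop :=
  forall l, Hspace a b c d k (fun z => f z l 0).

Definition wderivv {R : realType} (a b c d : R) (i j m : nat)
    (f : R * R -> 'cV[R]_m) : R * R -> 'cV[R]_m :=
  fun z => \col_l wderiv a b c d i j (fun w => f w l 0) z.

Definition corner_valuev {R : realType} (a b c d : R) (m : nat)
    (f : R * R -> 'cV[R]_m) : 'cV[R]_m :=
  \col_l corner_value a b c d (fun w => f w l 0).

Definition trace_yv {R : realType} (a b c d : R) (m : nat)
    (f : R * R -> 'cV[R]_m) : R -> 'cV[R]_m :=
  fun x => \col_l trace_y a b c d (fun w => f w l 0) x.

Definition trace_xv {R : realType} (a b c d : R) (m : nat)
    (f : R * R -> 'cV[R]_m) : R -> 'cV[R]_m :=
  fun y => \col_l trace_x a b c d (fun w => f w l 0) y.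

Definition intv {R : realType} (s t : R) (m : nat)
    (F : R -> 'cV[R]_m) : 'cV[R]_m :=
  \col_l \int[leb]_(x in `[s, t]) F x l 0.

(* u = (u_0, u_1, u_2) is a single stacked column-vector-valued function. *)

Definition blk0 {R : realType} (n0 n1 n2 : nat)
    (u : R * R -> 'cV[R]_(n0 + (n1 + n2))) : R * R -> 'cV[R]_n0 :=
  fun z => usubmx (u z).

Definition blk1 {R : realType} (n0 n1 n2 : nat)
    (u : R * R -> 'cV[R]_(n0 + (n1 + n2))) : R * R -> 'cV[R]_n1 :=
  fun z => usubmx (dsubmx (u z)).

Definition blk2 {R : realType} (n0 n1 n2 : nat)
    (u : R * R -> 'cV[R]_(n0 + (n1 + n2))) : R * R -> 'cV[R]_n2 :=
  fun z => dsubmx (dsubmx (u z)).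

Definition Dop {R : realType} (a b c d : R) (n0 n1 n2 : nat)
    (u : R * R -> 'cV[R]_(n0 + (n1 + n2))) :
    R * R -> 'cV[R]_(n0 + (n1 + n2)) :=
  fun z => col_mx (blk0 u z)
          (col_mx (wderivv a b c d 1 1 (blk1 u) z)
                  (wderivv a b c d 2 2 (blk2 u) z)).

Definition Lambda_bc {R : realType} (a b c d : R) (n0 n1 n2 : nat)
    (u : R * R -> 'cV[R]_(n0 + (n1 + n2))) :
    'cV[R]_(n1 + (n2 + (n2 + (n2 + n2)))) *
    (R -> 'cV[R]_(n1 + (n2 + n2))) * (R -> 'cV[R]_(n1 + (n2 + n2))) :=
  let u1 := blk1 u in
  let u2 := blk2 u in
  (col_mx (corner_valuev a b c d u1)
  (col_mx (corner_valuev a b c d u2)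
  (col_mx (corner_valuev a b c d (wderivv a b c d 1 0 u2))
  (col_mx (corner_valuev a b c d (wderivv a b c d 0 1 u2))
          (corner_valuev a b c d (wderivv a b c d 1 1 u2))))),
   fun x => col_mx (trace_yv a b c d (wderivv a b c d 1 0 u1) x)
           (col_mx (trace_yv a b c d (wderivv a b c d 2 0 u2) x)
                   (trace_yv a b c d (wderivv a b c d 2 1 u2) x)),
   fun y => col_mx (trace_xv a b c d (wderivv a b c d 0 1 u1) y)
           (col_mx (trace_xv a b c d (wderivv a b c d 0 2 u2) y)
                   (trace_xv a b c d (wderivv a b c d 1 2 u2) y))).

Definition K30 {R : realType} (a c : R) (n0 n1 n2 : nat) (x y : R) :
    'M[R]_(n0 + (n1 + n2), n1 + (n2 + (n2 + (n2 + n2)))) :=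
  col_mx 0
 (col_mx (row_mx 1%:M 0)
         (row_mx 0 (row_mx 1%:M (row_mx (x - a)%:M
           (row_mx (y - c)%:M ((y - c) * (x - a))%:M))))).

Definition K31 {R : realType} (c : R) (n0 n1 n2 : nat) (x y theta : R) :
    'M[R]_(n0 + (n1 + n2), n1 + (n2 + n2)) :=
  col_mx 0
 (col_mx (row_mx 1%:M 0)
         (row_mx 0 (row_mx (x - theta)%:M ((y - c) * (x - theta))%:M))).

Definition K32 {R : realType} (a : R) (n0 n1 n2 : nat) (x y nu : R) :
    'M[R]_(n0 + (n1 + n2), n1 + (n2 + n2)) :=
  col_mx 0
 (col_mx (row_mx 1%:M 0)
         (row_mx 0 (row_mx (y - nu)%:M ((x - a) * (y - nu))%:M))).

Definition K33 {R : realType} (n0 n1 n2 : nat) (x y theta nu : R) :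
    'M[R]_(n0 + (n1 + n2)) :=
  block_mx 0 0
           0 (block_mx 1%:M 0
                       0    ((x - theta) * (y - nu))%:M).

Definition T00 {R : realType} (n0 n1 n2 : nat) : 'M[R]_(n0 + (n1 + n2)) :=
  block_mx 1%:M 0
           0    0.

Definition K1op {R : realType} (a c : R) {n0 n1 n2 : nat}
    (v : 'cV[R]_(n1 + (n2 + (n2 + (n2 + n2)))) *
         (R -> 'cV[R]_(n1 + (n2 + n2))) * (R -> 'cV[R]_(n1 + (n2 + n2)))) :
    R * R -> 'cV[R]_(n0 + (n1 + n2)) :=
  let: (v0, v1, v2) := v in
  fun z => let: (x, y) := z in
    K30 a c n0 n1 n2 x y *m v0
    + intv a x (fun theta => K31 c n0 n1 n2 x y theta *m v1 theta)
    + intv c y (fun nu => K32 a n0 n1 n2 x y nu *m v2 nu).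

Definition K2op {R : realType} (a c : R) {n0 n1 n2 : nat}
    (w : R * R -> 'cV[R]_(n0 + (n1 + n2))) :
    R * R -> 'cV[R]_(n0 + (n1 + n2)) :=
  fun z => let: (x, y) := z in
    T00 n0 n1 n2 *m w (x, y)
    + intv a x (fun theta =>
        intv c y (fun nu => K33 n0 n1 n2 x y theta nu *m w (theta, nu))).

(* Main.v *)
(* On a rectangle, a function whose mixed weak derivatives F_x, F_y, F_xy are in
   L_2 equals, almost everywhere,
     F(a,c) + int_a^x F_x(t,c) dt + int_c^y F_y(a,s) ds + int_a^x int_c^y F_xy.
   Testing against tensor products phi(x) psi(y), where phi ranges over the
   derivatives of test functions, shows that F minus the x-primitive of F_x
   depends on y only; doing the same to F_x in y, and exchanging the variables,
   gives the formula with some L_1 functions in place of the traces. Its right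
   side is continuous, and the x-derivative of it is continuous in y for almost
   every x; this identifies the constant and the two L_1 functions with the
   corner value and the traces. For u_1 this is the claim. For u_2, apply it also
   to d_x u_2, d_y u_2 and d_x d_y u_2, substitute, and write each iterated
   primitive as a single one with kernel (x - t) or (y - s). *)
Require Import Defs.
From HB Require Import structures.
From mathcomp Require Import all_boot all_order all_algebra.
From mathcomp Require Import all_classical all_reals all_analysis.
From mathcomp Require Import measurable_realfun.
From mathcomp Require Import ring lra.

Set Implicit Arguments.
Unset Strict Implicit.
Unset Printing Implicit Defensive.

Import Order.TTheory GRing.Theory Num.Theory.
Import numFieldNormedType.Exports.

Local Open Scope classical_set_scope.
Local Open Scope ring_scope.

(** Weak derivatives are tested on products [phi x * psi y] only, which keeps every analytic
    argument one-dimensional and leaves the rest to Fubini. To apply Fubini without tracking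
    domains, functions are extended by 0 outside the rectangle and variable end points become
    factors of the integrand. Corner values, traces and weak derivatives are choices made by [xget],
    with default 0 if there is no candidate. Each identification therefore has two halves:
    uniqueness, since two continuous representatives that agree almost everywhere agree at the end
    point, and existence of a candidate. For traces existence is the delicate half: testing yields
    only L_1 functions [p] and [q], whereas a candidate must lie in L_2. Square integrability is
    recovered from one well-chosen line, on which the derivative is square integrable, together with
    Cauchy-Schwarz for the primitive of [W]. A second point: the derivative of order (2,0) is chosen
    as a derivative of u_2, not of the chosen derivative of order (1,0); testing with derivatives of
    test functions connects the two. *)

Inductive ck {R : realType} : nat -> (R -> R) -> Prop :=
| ck0 f of continuous f : ck 0 f
| ckS n (f f' : R -> R) of (forall x : R, is_derive x 1 f (f' x)) & ck n f' : ck n.+1 f.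

(** A proof of [ck] carries its derivatives as witnesses, so closure under sums, products and affine
    changes of variable is an induction on the order; [derive1] is identified with the witness only
    afterwards. *)
Definition smooth {R : realType} (f : R -> R) := forall n, ck n f.

(** * Smooth functions of one variable, bumps and test functions on an interval *)

Section smooth_functions.
Variable R : realType.
Implicit Types (f g : R -> R) (p : {poly R}).

Lemma ckSE n f : ck n.+1 f ->
  exists2 f' : R -> R, forall x : R, is_derive x 1 f (f' x) & ck n f'.
Proof. by move=> h; inversion h; subst; exists f'. Qed.

Lemma is_derive_continuous f f' :
  (forall x : R, is_derive x 1 f (f' x)) -> continuous f.
Proof.
by move=> df x; apply/differentiable_continuous/derivable1_diffP; have [] := df x.
Qed.

Lemma ck_continuous n f : ck n f -> continuous f.
Proof. by case=> // {n f} n f f' df _; exact: is_derive_continuous df. Qed.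

Lemma ckW n f : ck n.+1 f -> ck n f.
Proof.
elim: n f => [|n IHn] f; first by move/ck_continuous/ck0.
by move=> /ckSE[f' df /IHn]; exact: ckS.
Qed.

Lemma ck_cst n (k : R) : ck n (cst k).
Proof.
elim: n k => [|n IHn] k; first by apply: ck0 => x; exact: cvg_cst.
by apply: (ckS _ (IHn 0)) => x; exact: is_derive_cst.
Qed.

Lemma ckD n f g : ck n f -> ck n g -> ck n (fun x => f x + g x).
Proof.
elim: n f g => [|n IHn] f g.
  move=> /ck_continuous cf /ck_continuous cg; apply: ck0 => x.
  by apply: cvgD; [exact: cf|exact: cg].
move=> /ckSE[f' df cf] /ckSE[g' dg cg]; exact: (ckS _ (IHn _ _ cf cg)).
Qed.

Lemma ckM n f g : ck n f -> ck n g -> ck n (fun x => f x * g x).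
Proof.
elim: n f g => [|n IHn] f g.
  move=> /ck_continuous cf /ck_continuous cg; apply: ck0 => x.
  by apply: cvgM; [exact: cf|exact: cg].
move=> ckf ckg; have [f' df cf] := ckSE ckf; have [g' dg cg] := ckSE ckg.
apply: (@ckS _ _ _ (fun x => f x * g' x + g x * f' x)).
by apply: ckD; apply: IHn => //; exact: ckW.
Qed.

Lemma ck_affine n f (k m : R) : ck n f -> ck n (fun x => f (k * x + m)).
Proof.
have dA (x : R) : is_derive x 1 (fun x => k * x + m) k.
  apply: (@is_derive_eq _ _ _ (fun x => k *: x + m)).
  by rewrite /GRing.scale /= addr0 mulr1.
elim: n f => [|n IHn] f.
  move=> /ck_continuous cf; apply: ck0 => x.
  apply: (@continuous_comp _ _ _ (fun x => k * x + m) f); last exact: cf.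
  exact: (is_derive_continuous dA).
move=> /ckSE[f' df cf].
apply: (@ckS _ _ _ (fun x => f' (k * x + m) * k)).
by apply: ckM; [exact: IHn|exact: ck_cst].
Qed.

(* Stability of this family under derivation makes [flat 1 x = exp (- 1 / x)],
   extended by [0], a smooth function. *)
Definition flat p (x : R) : R :=
  if 0 < x then p.[x^-1] * expR (- x^-1) else 0.

(** Chain rule: differentiating [p.[x^-1] * expR (- x^-1)] brings out [x^-2], the value of ['X^2] at
    [x^-1], times the value there of p minus its derivative. *)
Definition flat_deriv p := 'X^2 * (p - p^`()).

(** Made for the difference quotient of [flat] at 0, with [t = h^-1]: division by [h] costs one
    power of [t], so decay of order 2 still leaves a factor [h]. The polynomial is at most a
    constant times [t ^+ m], and [expR t] is bounded below by the term of degree m + 2 of its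
    series, whence the factorial in the constant. *)
Lemma poly_expRN_le p : exists2 M, 0 <= M &
  forall t : R, 1 <= t -> `|p.[t] * expR (- t)| <= M / t ^+ 2.
Proof.
have [m [M [M0 pM]]] : exists m M, 0 <= M /\
    forall t : R, 1 <= t -> `|p.[t]| <= M * t ^+ m.
  elim/poly_ind: p => [|p c [m [M [M0 IH]]]].
    by exists 0%N, 0; split=> // t _; rewrite horner0 normr0 mul0r.
  exists m.+1, (M + `|c|); split=> [|t t1]; first by rewrite addr_ge0.
  have t0 : 0 <= t by rewrite (le_trans _ t1).
  rewrite hornerMXaddC (le_trans (ler_normD _ _))// mulrDl lerD//.
    by rewrite normrM (ger0_norm t0) exprSr mulrA ler_wpM2r// IH.
  by rewrite ler_peMr// exprn_ege1.
exists (M * m.+2`!%:R) => [|t t1]; first by rewrite mulr_ge0.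
have t0 : 0 < t by rewrite (lt_le_trans _ t1).
rewrite normrM (ger0_norm (expR_ge0 _)) (le_trans (ler_wpM2r (expR_ge0 _) (pM _ t1)))//.
rewrite expRN -!mulrA ler_wpM2l// ler_pdivrMr ?expR_gt0// mulrAC.
rewrite ler_pdivlMr ?exprn_gt0// -exprD addn2 -ler_pdivrMl ?ltr0n ?fact_gt0//.
rewrite mulrC; apply: le_trans (expR_ge1Dxn m.+1 (ltW t0)).
by rewrite lerDr.
Qed.

Lemma is_derive_flat p (x : R) : is_derive x 1 (flat p) (flat (flat_deriv p) x).
Proof.
have [x0|x0|->] := ltgtP x 0.
- rewrite {2}/flat (lt_gtF x0); apply: (@near_eq_is_derive R R R (cst 0)).
  near=> y; have y0 : y < 0 by near: y; exact: lt_nbhsl.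
  by rewrite /flat (lt_gtF y0).
- apply: (@near_eq_is_derive R R R (fun y => p.[y^-1] * expR (- y^-1))).
    near=> y; have y0 : 0 < y by near: y; exact: lt_nbhsr.
    by rewrite /flat y0.
  have xn0 : x != 0 by rewrite gt_eqF.
  have dV : is_derive x 1 (fun y : R => y^-1) (- x ^- 2).
    apply: is_derive_eq; first exact: (@is_deriveV R id x 1 1).
    by rewrite /GRing.scale /= mulr1.
  have dp : is_derive x 1 (fun y : R => p.[y^-1]) (p^`().[x^-1] * - x ^- 2).
    exact: is_derive1_comp.
  have de : is_derive x 1 (fun y : R => expR (- y^-1)) (expR (- x^-1) * x ^- 2).
    have dN : is_derive x 1 (fun y : R => - y^-1) (x ^- 2).
      by apply: is_derive_eq; rewrite opprK.
    exact: (@is_derive1_comp _ expR).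
  apply: is_derive_eq.
  rewrite {1}/flat x0 /flat_deriv !(hornerE, hornerXn) /GRing.scale/= exprVn.
  by ring.
- rewrite {2}/flat ltxx.
  have [M M0 Mp] := poly_expRN_le p.
  (* The quotient is zero for negative [h] and at most [h * M] in absolute value for [0 < h < 1].
     Dividing [e] by [M + 1] covers the case [M = 0]. *)
  have H : (fun h : R => h^-1 *: ((flat p \o shift 0) (h *: 1) - flat p 0))
      h @[h --> 0^'] --> (0 : R).
    apply/cvgr0Pnorm_lt => e e0; near=> h.
    rewrite /= /flat ltxx subr0 addr0 /GRing.scale /= mulr1.
    have [h0|] := ltP 0 h; last by rewrite mulr0 normr0.
    have hn0 : h != 0 by rewrite gt_eqF.
    have h1 : `|h| < 1 by near: h; exact: dnbhs0_lt.
    have he : `|h| < e / (M + 1).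
      by near: h; apply: dnbhs0_lt; rewrite divr_gt0// ltr_wpDl.
    rewrite (gtr0_norm h0) in h1 he.
    rewrite normrM gtr0_norm ?invr_gt0//.
    have /(Mp _) : 1 <= h^-1 by rewrite invf_ge1// ltW.
    move=> /(ler_wpM2l (ltW (eq_ind_r (fun b => is_true b) h0 (invr_gt0 h)))) /le_lt_trans; apply.
    rewrite exprVn invrK (_ : _ * _ = h * M); last by field.
    rewrite ltr_pdivlMr ?ltr_wpDl// in he.
    by apply: le_lt_trans he; rewrite ler_wpM2l ?(ltW h0)// lerDl.
  by apply: DeriveDef; [exact: cvgP H|exact: cvg_lim H].
Unshelve. all: by end_near.
Qed.

Lemma smooth_flat p : smooth (flat p).
Proof.
move=> n; elim: n p => [|n IHn] p.
  exact/ck0/(is_derive_continuous (is_derive_flat p)).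
exact: (ckS (is_derive_flat p) (IHn _)).
Qed.

Lemma smooth_derive1 f : smooth f -> smooth (derive1 f).
Proof.
move=> sf n; have [f' df cf] := ckSE (sf n.+1).
rewrite (_ : derive1 f = f')//; apply/funext => x.
by rewrite derive1E; have [] := df x.
Qed.

Lemma smooth_is_derive f (x : R) : smooth f -> is_derive x 1 f (derive1 f x).
Proof.
move=> sf; have [f' df _] := ckSE (sf 1%N).
by rewrite derive1E; apply/derivableP; have [] := df x.
Qed.

Lemma smooth_continuous f : smooth f -> continuous f.
Proof. by move=> sf; exact: ck_continuous (sf 0%N). Qed.

Lemma flat1_gt0 (x : R) : 0 < x -> flat 1 x = expR (- x^-1).
Proof. by move=> x0; rewrite /flat x0 hornerC mul1r. Qed.

Lemma flat1_le0 (x : R) : x <= 0 -> flat 1 x = 0.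
Proof. by rewrite leNgt /flat => /negbTE ->. Qed.

Lemma flat1_ge0_le1 (x : R) : 0 <= flat 1 x <= 1.
Proof.
have [x0|x0] := ltP 0 x; last by rewrite flat1_le0// lexx ler01.
by rewrite flat1_gt0// expR_ge0 expR_le1 oppr_le0 invr_ge0 ltW.
Qed.

Definition bump n (s t x : R) : R :=
  flat 1 (n%:R * x + (- (n%:R * s) - 1)) * flat 1 (- n%:R * x + (n%:R * t - 1)).

Lemma smooth_bump n s t : smooth (bump n s t).
Proof. by move=> k; apply: ckM; apply: ck_affine; exact: smooth_flat. Qed.

Lemma bump_ge0_le1 n s t x : 0 <= bump n s t x <= 1.
Proof.
have /andP[f0 f1] := flat1_ge0_le1 (n%:R * x + (- (n%:R * s) - 1)).
have /andP[g0 g1] := flat1_ge0_le1 (- n%:R * x + (n%:R * t - 1)).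
by rewrite /bump mulr_ge0//= mulr_ile1.
Qed.

Lemma bump_eq0 n s t x :
  x \notin `[s + n.+1%:R^-1, t - n.+1%:R^-1] -> bump n.+1 s t x = 0.
Proof.
rewrite in_itv/= negb_and -!ltNge /bump => /orP[xs|tx].
  rewrite flat1_le0 ?mul0r//.
  have : n.+1%:R * x <= n.+1%:R * (s + n.+1%:R^-1) by rewrite ler_pM2l// ltW.
  by rewrite mulrDr mulfV//; lra.
rewrite [X in _ * X]flat1_le0 ?mulr0//.
have : n.+1%:R * (t - n.+1%:R^-1) <= n.+1%:R * x by rewrite ler_pM2l// ltW.
by rewrite mulrBr mulfV//; lra.
Qed.

Lemma flat1_cvg : flat 1 x @[x --> +oo] --> (1 : R).
Proof.
have V0 : (x^-1 : R) @[x --> +oo] --> (0 : R).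
  apply/gtr0_cvgV0; last exact: cvg_id.
  by near=> x; near: x; exact: nbhs_pinfty_gt.
have : expR (- x^-1) @[x --> +oo] --> expR (- (0 : R)).
  apply: continuous_cvg; first exact: continuous_expR.
  exact: cvgN V0.
rewrite oppr0 expR0; apply: cvg_trans; apply: near_eq_cvg; near=> x.
by rewrite flat1_gt0//; near: x; exact: nbhs_pinfty_gt.
Unshelve. all: by end_near. Qed.

Lemma flat1_cvgn (k m : R) : 0 < k ->
  flat 1 (n.+1%:R * k + m) @[n --> \oo] --> (1 : R).
Proof.
move=> k0; apply: (@cvg_comp _ _ _ _ (flat 1) _ +oo); last exact: flat1_cvg.
apply/cvgryPge => A; near=> n.
rewrite -lerBlDr -ler_pdivrMr// (@le_trans _ _ n%:R)// ?ler_nat//.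
by near: n; exact: nbhs_infty_ger.
Unshelve. all: by end_near. Qed.

Lemma bump_cvg s t (x : R) :
  bump n.+1 s t x @[n --> \oo] --> (\1_`]s, t[%classic x : R).
Proof.
rewrite indicE; have [xst|xst] := boolP (x \in `]s, t[).
  rewrite mem_set// -[X in _ --> X]mulr1.
  move: xst; rewrite in_itv/= => /andP[sx xt].
  apply: cvgM.
    apply: cvg_trans (flat1_cvgn (- 1) (_ : 0 < x - s)); last by rewrite subr_gt0.
    by apply: near_eq_cvg; near=> n; congr flat; ring.
  apply: cvg_trans (flat1_cvgn (- 1) (_ : 0 < t - x)); last by rewrite subr_gt0.
  by apply: near_eq_cvg; near=> n; congr flat; ring.
rewrite memNset//=; last exact/negP.
apply: cvg_near_cst; near=> n; apply: bump_eq0; apply: contra xst.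
rewrite !in_itv/= => /andP[sx xt].
by rewrite (lt_le_trans _ sx) ?ltrDl//= (le_lt_trans xt)// ltrBlDr ltrDl.
Unshelve. all: by end_near. Qed.

(** An explicit interval replaces the closure of the nonvanishing set. It may be empty, and then the
    function is zero; [bump] produces this case for small [n]. *)
Definition test1 (a b : R) f := smooth f /\
  exists s t, [/\ a < s, t < b & forall x, x \notin `[s, t] -> f x = 0].

Lemma test1_bump n (a b s t : R) : a <= s -> t <= b -> test1 a b (bump n.+1 s t).
Proof.
move=> sa tb; split; first exact: smooth_bump.
exists (s + n.+1%:R^-1), (t - n.+1%:R^-1); split.
- by rewrite (le_lt_trans sa)// ltrDl.
- by rewrite (lt_le_trans _ tb)// ltrBlDr ltrDl.
- by move=> x; exact: bump_eq0.
Qed.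

Lemma test1_derive1 (a b : R) f : test1 a b f -> test1 a b (derive1 f).
Proof.
move=> [sf [s [t [sa tb f0]]]]; split; first exact: smooth_derive1.
exists s, t; split=> // x xst; rewrite derive1E.
have -> : 'D_1 f x = 'D_1 (cst 0) x; last exact: derive_cst.
apply: near_eq_derive; move: xst.
rewrite in_itv/= negb_and -!ltNge => /orP[xs|tx]; near=> y.
  rewrite f0// in_itv/= negb_and -!ltNge; apply/orP; left.
  by near: y; exact: lt_nbhsl.
rewrite f0// in_itv/= negb_and -!ltNge; apply/orP; right.
by near: y; exact: lt_nbhsr.
Unshelve. all: by end_near. Qed.

Lemma test1_eq0 (a b : R) f x : test1 a b f -> x \notin `]a, b[ -> f x = 0.
Proof.
move=> [_ [s [t [sa tb f0]]]] xab; apply: f0; apply: contra xab.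
rewrite !in_itv/= => /andP[sx xt].
by rewrite (lt_le_trans sa)//= (le_lt_trans xt).
Qed.

Lemma smoothD f g : smooth f -> smooth g -> smooth (fun x => f x + g x).
Proof. by move=> sf sg n; exact: ckD. Qed.

Lemma smoothZ k f : smooth f -> smooth (fun x => k * f x).
Proof. by move=> sf n; apply: ckM => //; exact: ck_cst. Qed.

Lemma test1Z (a b k : R) f : test1 a b f -> test1 a b (fun x => k * f x).
Proof.
move=> [sf [s [t [sa tb f0]]]]; split; first exact: smoothZ.
by exists s, t; split=> // x xst; rewrite f0// mulr0.
Qed.

Lemma test1D (a b : R) f g :
  test1 a b f -> test1 a b g -> test1 a b (fun x => f x + g x).
Proof.
move=> [sf [s [t [sa tb f0]]]] [sg [s' [t' [sa' tb' g0]]]].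
split; first exact: smoothD.
exists (Num.min s s'), (Num.max t t'); split=> [||x].
- by rewrite lt_min sa.
- by rewrite gt_max tb.
rewrite in_itv/= ge_min le_max => h; rewrite f0 ?g0 ?addr0// in_itv/=;
  apply: contra h => /andP[-> ->]; rewrite ?orbT//.
Qed.

End smooth_functions.

Definition tensor {R : realType} (f g : R -> R) : R * R -> R :=
  fun z => f z.1 * g z.2.

(** * Products of one-variable test functions are test functions on the rectangle *)

Section tensor_test_functions.
Variable R : realType.
Implicit Types (f g : R -> R) (z : R * R).

Lemma is_derive_fst_x f z : derivable f z.1 1 ->
  is_derive z ((1, 0) : R * R) (f \o fst) (derive1 f z.1).
Proof.
move=> df; rewrite derive1E; split.
  by rewrite /derivable/= in df *; exact: df.
by [].
Qed.

Lemma is_derive_snd_y f z : derivable f z.2 1 ->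
  is_derive z ((0, 1) : R * R) (f \o snd) (derive1 f z.2).
Proof.
by move=> df; rewrite derive1E; split.
Qed.

Lemma is_derive_snd_x f z : is_derive z ((1, 0) : R * R) (f \o snd) 0.
Proof.
have : (fun h : R => h^-1 *: (((f \o snd) \o shift z) (h *: ((1, 0) : R * R)) - (f \o snd) z))
    h @[h --> 0^'] --> (0 : R).
  apply: cvg_near_cst; near=> h; rewrite /= /GRing.scale/= mulr0 add0r subrr.
  by rewrite mulr0.
by move=> H; apply: DeriveDef; [exact: cvgP H|exact: cvg_lim H].
Unshelve. all: by end_near. Qed.

Lemma is_derive_fst_y f z : is_derive z ((0, 1) : R * R) (f \o fst) 0.
Proof.
have : (fun h : R => h^-1 *: (((f \o fst) \o shift z) (h *: ((0, 1) : R * R)) - (f \o fst) z))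
    h @[h --> 0^'] --> (0 : R).
  apply: cvg_near_cst; near=> h; rewrite /= /GRing.scale/= mulr0 add0r subrr.
  by rewrite mulr0.
by move=> H; apply: DeriveDef; [exact: cvgP H|exact: cvg_lim H].
Unshelve. all: by end_near. Qed.

Lemma is_derive_tensor_x f g z : derivable f z.1 1 ->
  is_derive z ((1, 0) : R * R) (tensor f g) (tensor (derive1 f) g z).
Proof.
move=> df; have df1 := is_derive_fst_x df; have dg := is_derive_snd_x g z.
apply: (@is_derive_eq _ _ _ ((f \o fst) * (g \o snd))).
by rewrite /GRing.scale/= mulr0 add0r mulrC.
Qed.

Lemma is_derive_tensor_y f g z : derivable g z.2 1 ->
  is_derive z ((0, 1) : R * R) (tensor f g) (tensor f (derive1 g) z).
Proof.
move=> dg; have dg1 := is_derive_snd_y dg; have df := is_derive_fst_y f z.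
apply: (@is_derive_eq _ _ _ ((f \o fst) * (g \o snd))).
by rewrite /GRing.scale/= mulr0 addr0.
Qed.

Lemma smooth_derivable f (x : R) : smooth f -> derivable f x 1.
Proof. by move=> /(smooth_is_derive x)[]. Qed.

Lemma pdx_tensor f g : smooth f -> pdx (tensor f g) = tensor (derive1 f) g.
Proof.
move=> sf; apply/funext => z.
by have [] := is_derive_tensor_x g (@smooth_derivable f z.1 sf).
Qed.

Lemma pdy_tensor f g : smooth g -> pdy (tensor f g) = tensor f (derive1 g).
Proof.
move=> sg; apply/funext => z.
by have [] := is_derive_tensor_y f (@smooth_derivable g z.2 sg).
Qed.

Lemma continuous_tensor f g : continuous f -> continuous g ->
  continuous (tensor f g).
Proof.
move=> cf cg z; apply: cvgM.
  by apply: (@continuous_comp _ _ _ fst f); [exact: cvg_fst|exact: cf].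
by apply: (@continuous_comp _ _ _ snd g); [exact: cvg_snd|exact: cg].
Qed.

Lemma is_Ck_tensor k f g : smooth f -> smooth g -> is_Ck k (tensor f g).
Proof.
elim: k f g => [|k IHk] f g sf sg; split=> //;
  try exact: continuous_tensor (smooth_continuous sf) (smooth_continuous sg).
split=> [z|z||].
- by have [] := is_derive_tensor_x g (@smooth_derivable f z.1 sf).
- by have [] := is_derive_tensor_y f (@smooth_derivable g z.2 sg).
- by rewrite pdx_tensor//; apply: IHk => //; exact: smooth_derive1.
- by rewrite pdy_tensor//; apply: IHk => //; exact: smooth_derive1.
Qed.

(** The nonvanishing set lies in a product of two segments, which is compact, hence closed, and
    inside the open rectangle; so its closure stays there too. *)
Lemma test_function_tensor (a b c d : R) f g :
  test1 a b f -> test1 c d g -> test_function a b c d (tensor f g).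
Proof.
move=> [sf [s [t [sa tb f0]]]] [sg [s' [t' [sc td g0]]]].
have Kcomp : compact (`[s, t]%classic `*` `[s', t']%classic : set (R * R)).
  by apply: compact_setX; exact: segment_compact.
have Kcl : closed (`[s, t]%classic `*` `[s', t']%classic : set (R * R)).
  by apply: compact_closed => //; exact: order_hausdorff.
have sub : closure [set z | tensor f g z != 0] `<=`
    `[s, t]%classic `*` `[s', t']%classic.
  rewrite [X in _ `<=` X](closure_id _).1//; apply: closure_subset => -[x y] /=.
  rewrite /tensor/= mulf_eq0 negb_or => /andP[fx gy].
  by split; [apply: contraNT fx => /f0/eqP|apply: contraNT gy => /g0/eqP].
split=> [k||].
- exact: is_Ck_tensor.
- by apply: subclosed_compact sub => //; exact: closed_closure.
- apply: (subset_trans sub) => -[x y] /= []; rewrite !in_itv/=.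
  move=> /andP[sx xt] /andP[sy yt]; split.
    by rewrite /= in_itv/= (lt_le_trans sa)//= (le_lt_trans xt).
  by rewrite /= in_itv/= (lt_le_trans sc)//= (le_lt_trans yt).
Qed.

End tensor_test_functions.

Lemma aeS d (T : measurableType d) (R : realType)
    (nu : {measure set T -> \bar R}) (P Q : T -> Prop) :
  (forall x, P x -> Q x) -> (\forall x \ae nu, P x) -> \forall x \ae nu, Q x.
Proof. by move=> PQ; exact: filterS. Qed.

Lemma aeI d (T : measurableType d) (R : realType)
    (nu : {measure set T -> \bar R}) (P Q : T -> Prop) :
  (\forall x \ae nu, P x) -> (\forall x \ae nu, Q x) ->
  \forall x \ae nu, P x /\ Q x.
Proof. by move=> aP aQ; exact: filterI. Qed.

(** * Fubini for real-valued integrals, and null sets of the plane *)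

Section integration_toolkit.
Context {R : realType}.
Local Notation mu := (@lebesgue_measure R).
Local Notation mu2 := (mu \x mu)%E.
Implicit Types (f g : R -> R) (F : R * R -> R).

(** Tonelli applies to the positive and the negative part in the extended reals; [fine] brings the
    difference of the two integrals back to the reals. *)
Lemma measurable_Rintegral d (T : measurableType d) (K : T * measurableTypeR R -> R) :
  measurable_fun setT K ->
  measurable_fun setT (fun x => \int[mu]_y K (x, y)).
Proof.
move=> mK; pose E : T * measurableTypeR R -> \bar R := EFin \o K.
have mE : measurable_fun setT E by exact/measurable_EFinP.
apply: (@measurableT_comp _ _ _ _ _ _ fine _ (fun x => \int[mu]_y (K (x, y))%:E)%E).
  by [].
rewrite (_ : (fun _ => _) = (fun x => \int[mu]_y E^\+ (x, y)) \-
    (fun x => \int[mu]_y E^\- (x, y)))%E; last first.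
  by apply/funext => x; rewrite [LHS]integralE; congr (_ - _)%E;
  apply: eq_integral => y _; rewrite ?(funeposE, funenegE).
apply: emeasurable_funB.
  apply: (measurable_fun_fubini_tonelli_F (m2 := mu)) => //.
  exact: measurable_funepos.
apply: (measurable_fun_fubini_tonelli_F (m2 := mu)) => //.
exact: measurable_funeneg.
Qed.

Lemma ae_eq_integrable d (T : measurableType d)
    (nu : {measure set T -> \bar R}) (f g : T -> \bar R) :
  measurable_fun setT g -> ae_eq nu setT f g ->
  nu.-integrable setT f -> nu.-integrable setT g.
Proof.
move=> mg fg /integrableP[mf fi]; apply/integrableP; split=> //.
rewrite -(@ae_eq_integral _ _ _ nu setT (abse \o g) (abse \o f)) //.
- exact: measurableT_comp.
- exact: measurableT_comp.
- exact: ae_eq_abse.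
Qed.

Section fubini.
Variable F : R * R -> R.
Hypothesis iF : mu2.-integrable setT (EFin \o F).

Lemma ae_integrable_x : \forall x \ae mu,
  mu.-integrable setT (EFin \o (fun y => F (x, y))).
Proof. exact: (ae_integrable1 iF). Qed.

Lemma ae_integrable_y : \forall y \ae mu,
  mu.-integrable setT (EFin \o (fun x => F (x, y))).
Proof. exact: (ae_integrable2 iF). Qed.

(** The extended and the real marginal can differ only where the section is not integrable, since
    [fine] sends an infinite value to 0; such [x] form a null set. *)
Let fineF : ae_eq mu setT (fubini_F mu (EFin \o F))
  (fun x => (\int[mu]_y F (x, y))%:E).
Proof.
move: ae_integrable_x; apply: aeS => x ix _.
by rewrite /Rintegral fineK//; exact: integrable_fin_num.
Qed.

Let fineG : ae_eq mu setT (fubini_G mu (EFin \o F))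
  (fun y => (\int[mu]_x F (x, y))%:E).
Proof.
move: ae_integrable_y; apply: aeS => x ix _.
by rewrite /Rintegral fineK//; exact: integrable_fin_num.
Qed.

Let mfineF : measurable_fun [set: measurableTypeR R] (fun x => (\int[mu]_y F (x, y))%:E).
Proof.
apply/measurable_EFinP; apply: (@measurable_Rintegral _ (measurableTypeR R)).
apply/measurable_EFinP.
have H := measurable_int mu2 iF.
exact: H.
Qed.

Let mfineG : measurable_fun [set: measurableTypeR R] (fun y => (\int[mu]_x F (x, y))%:E).
Proof.
apply/measurable_EFinP; apply: (@measurable_Rintegral _ (measurableTypeR R) (F \o unstable.swap)).
apply: measurableT_comp; last exact: measurable_swap.
apply/measurable_EFinP.
have H := measurable_int mu2 iF.
exact: H.
Qed.

Lemma integrable_Rintegral_x :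
  mu.-integrable setT (EFin \o (fun x => \int[mu]_y F (x, y))).
Proof.
apply: (ae_eq_integrable _ fineF); first exact: mfineF.
exact: integrable_fubini_F.
Qed.

Lemma Rfubini_xy : \int[mu2]_z F z = \int[mu]_x \int[mu]_y F (x, y).
Proof.
congr fine; rewrite -(integral12_prod_meas1 iF).
apply: ae_eq_integral; [by []| |exact: mfineF|exact: fineF].
exact: (measurable_fubini_F iF).
Qed.

Lemma Rfubini_yx : \int[mu2]_z F z = \int[mu]_y \int[mu]_x F (x, y).
Proof.
congr fine; rewrite -(integral21_prod_meas1 iF).
apply: ae_eq_integral; [by []| |exact: mfineG|exact: fineG].
have := measurable_fubini_G iF; exact.
Qed.

End fubini.

Lemma integrable_measurable F : mu2.-integrable setT (EFin \o F) ->
  measurable_fun [set: measurableTypeR R * measurableTypeR R] F.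
Proof.
by move=> iF; apply/measurable_EFinP; have H := measurable_int mu2 iF; exact: H.
Qed.

Lemma integrable_swap F : mu2.-integrable setT (EFin \o F) ->
  mu2.-integrable setT (EFin \o (F \o unstable.swap)).
Proof.
move=> iF; have mF := measurable_int mu2 iF.
have mFs : measurable_fun [set: measurableTypeR R * measurableTypeR R] (EFin \o (F \o unstable.swap)).
  apply: (@measurableT_comp _ _ _ _ _ _ (EFin \o F)) => //.
  exact: measurable_swap.
by apply: (@integrable21ltyP _ _ _ _ _ mu mu _ mFs).2; have := (@integrable12ltyP _ _ _ _ _ mu mu _ mF).1 iF; exact.
Qed.

Lemma integrable_Rintegral_y F : mu2.-integrable setT (EFin \o F) ->
  mu.-integrable setT (EFin \o (fun y => \int[mu]_x F (x, y))).
Proof. by move=> /integrable_swap; exact: integrable_Rintegral_x. Qed.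

Lemma Rintegral_swap F : mu2.-integrable setT (EFin \o F) ->
  \int[mu2]_z F (unstable.swap z) = \int[mu2]_z F z.
Proof.
by move=> iF; rewrite (Rfubini_xy (integrable_swap iF)) (Rfubini_yx iF).
Qed.

(** The product measure of the exceptional set is by definition the integral of the measures of its
    sections; a nonnegative function of integral 0 is 0 almost everywhere. *)
Lemma ae_xy (P : R * R -> Prop) : (\forall z \ae mu2, P z) ->
  \forall x \ae mu, \forall y \ae mu, P (x, y).
Proof.
move=> [N [mN N0 PN]].
have : (\int[mu]_x (mu \o xsection N) x = 0)%E by [].
have mx : measurable_fun setT (mu \o xsection N) by exact: measurable_fun_xsection.
rewrite (eq_integral (fun x => `|(mu \o xsection N) x|)%E); last first.
  by move=> x _; rewrite gee0_abs.
move/(ae_eq_integral_abs _ _ mx) => /(_ measurableT).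
apply: aeS => x /(_ I) xN0; exists (xsection N x); split => //.
  exact: measurable_xsection.
by move=> y /= Py; rewrite /xsection/= inE; exact: PN.
Qed.

(** Uniqueness of the product measure: integrating the slices in the other direction gives the same
    measure, and in that direction the slices of the preimage are those of [A]. *)
Lemma product_swap (A : set (measurableTypeR R * measurableTypeR R)) : measurable A -> mu2 (unstable.swap @^-1` A) = mu2 A.
Proof.
move=> mA; rewrite (@product_measure_unique _ _ _ _ _ mu mu (mu \x^ mu)%E)//.
  exact: product_measure2E.
rewrite -[X in measurable X]setTI; exact: measurable_swap.
Qed.

Lemma ae_swap (P : R * R -> Prop) : (\forall z \ae mu2, P z) ->
  \forall z \ae mu2, P (unstable.swap z).
Proof.
move=> [N [mN N0 PN]]; exists (unstable.swap @^-1` N); split=> [||z /= nP].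
- rewrite -[X in measurable X]setTI; exact: measurable_swap.
- by rewrite product_swap.
- exact: PN.
Qed.

Lemma ae_fst (P : R -> Prop) : (\forall x \ae mu, P x) -> \forall z \ae mu2, P z.1.
Proof.
move=> [N [mN N0 PN]]; exists (N `*` setT); split=> [||z /= nP].
- exact: measurableX.
- by rewrite product_measure1E// [X in (X * _)%E]N0 mul0e.
- by split=> //; exact: PN.
Qed.

Lemma ae_snd (P : R -> Prop) : (\forall x \ae mu, P x) -> \forall z \ae mu2, P z.2.
Proof. by move=> /ae_fst/ae_swap; apply: aeS => -[]. Qed.

End integration_toolkit.

(** * Primitives written with kernels, and primitives of test functions *)

Section primitives.
Context {R : realType}.
Local Notation mu := (@lebesgue_measure R).
Local Notation mu2 := (mu \x mu)%E.
Local Notation mR := (measurableTypeR R).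
Implicit Types (f g : R -> R) (F G : R * R -> R).

Lemma integrableT_measurable d (T : measurableType d)
    (nu : {measure set T -> \bar R}) (f : T -> R) :
  nu.-integrable setT (EFin \o f) -> measurable_fun setT f.
Proof. by move=> /integrableP[/measurable_EFinP]. Qed.

Lemma integrable_le d (T : measurableType d)
    (nu : {measure set T -> \bar R}) (f g : T -> R) :
  measurable_fun setT f -> (forall x, `|f x| <= g x) ->
  nu.-integrable setT (EFin \o g) -> nu.-integrable setT (EFin \o f).
Proof.
move=> mf fg; apply: le_integrable => //; first exact/measurable_EFinP.
by move=> x _ /=; rewrite lee_fin (le_trans (fg x)) ?ler_norm.
Qed.

Lemma integrableM_bounded d (T : measurableType d)
    (nu : {measure set T -> \bar R}) (f h : T -> R) (M : R) :
  measurable_fun setT h -> (forall x, `|h x| <= M) ->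
  nu.-integrable setT (EFin \o f) ->
  nu.-integrable setT (EFin \o (fun x => f x * h x)).
Proof.
move=> mh hM fi.
apply: (@integrable_le _ _ _ _ (fun x => M * `|f x|)).
- by apply: measurable_funM => //; exact: integrableT_measurable fi.
- by move=> x; rewrite normrM mulrC ler_wpM2r.
have : nu.-integrable setT (fun x => (M%:E * (`|f x|)%:E)%E).
  apply: integrableZl => //.
  exact: integrable_abse fi.
by apply: eq_integrable => // x _; rewrite /= EFinM.
Qed.

Lemma measurable_ler_indic d (T : measurableType d) (u v : T -> R) :
  measurable_fun setT u -> measurable_fun setT v ->
  measurable_fun setT (fun t => ((u t <= v t)%R%:R) : R).
Proof.
move=> mu_ mv.
have -> : (fun t => ((u t <= v t)%R%:R) : R) =
    (\1_(`[0, +oo[%classic) : R -> R) \o (fun t => v t - u t).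
  apply/funext => t /=; rewrite indicE; congr (nat_of_bool _)%:R.
  rewrite -(subr_ge0 (u t)); apply/idP/idP => h.
    by rewrite mem_set//= in_itv/= h.
  by move: h; rewrite inE/= in_itv/= andbT.
apply: measurableT_comp; last exact: measurable_funB.
exact: measurable_indic.
Qed.

Lemma integrable_tensor f g : mu.-integrable setT (EFin \o f) ->
  mu.-integrable setT (EFin \o g) -> mu2.-integrable setT (EFin \o tensor f g).
Proof.
move=> fi gi.
have mf : measurable_fun [set: mR] f by exact: integrableT_measurable fi.
have mg : measurable_fun [set: mR] g by exact: integrableT_measurable gi.
have mt : measurable_fun [set: mR * mR] (EFin \o tensor f g).
  apply/measurable_EFinP; apply: measurable_funM.
    by apply: (measurableT_comp mf); exact: measurable_fst.
  by apply: (measurableT_comp mg); exact: measurable_snd.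
apply: (@integrable12ltyP _ _ _ _ _ mu mu _ mt).2.
have gfin : (\int[mu]_y (`|g y|)%:E)%E \is a fin_num.
  by apply: integrable_fin_num => //; exact: integrable_abse gi.
rewrite (eq_integral (fun x : mR => (`|f x|)%:E * \int[mu]_y (`|g y|)%:E)%E); last first.
  move=> x _; rewrite -ge0_integralZl//; last first.
    by apply/measurable_EFinP; exact: measurableT_comp.
  by apply: eq_integral => y _; rewrite /= /tensor normrM EFinM.
rewrite -(fineK gfin) ge0_integralZr//.
- rewrite lte_mul_pinfty//; first by apply: integral_ge0.
    by rewrite integrable_fin_num//; exact: integrable_abse fi.
  by rewrite fineK// ltey_eq gfin.
- by apply/measurable_EFinP; exact: measurableT_comp.
- by rewrite fineK//; apply: integral_ge0.
Qed.

(** For [x < a] the interval is empty and the value is 0, unlike that of an oriented integral. *)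
Definition prim (a : R) f (x : R) : R := \int[mu]_(t in `[a, x]) f t.

Definition step (s t : R) : R := ((s <= t)%R)%:R.

Lemma step_ge0_le1 s t : 0 <= step s t <= 1.
Proof. by rewrite /step; case: (s <= t); rewrite /= ?lexx ?ler01. Qed.

Lemma measurable_step d (T : measurableType d) (u v : T -> R) :
  measurable_fun setT u -> measurable_fun setT v ->
  measurable_fun setT (fun t => step (u t) (v t)).
Proof. exact: measurable_ler_indic. Qed.

Lemma norm_stepM_le1 s t s' t' : `|step s t * step s' t'| <= 1.
Proof.
have /andP[h0 h1] := step_ge0_le1 s t; have /andP[k0 k1] := step_ge0_le1 s' t'.
by rewrite ger0_norm ?mulr_ge0// mulr_ile1.
Qed.

(** The variable end point becomes a bounded measurable factor of an integrand on the whole line, so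
    integrability is kept and Fubini applies to expressions that contain primitives. *)
Lemma prim_kernel a f x :
  prim a f x = \int[mu]_t (f t * (step a t * step t x)).
Proof.
rewrite /prim Rintegral_mkcond; apply: eq_Rintegral => t _.
rewrite patchE /step; case: ifPn => [|tax].
  by rewrite inE/= in_itv/= => /andP[-> ->]; rewrite !mulr1.
have [/= at_|//] := boolP (a <= t); last by rewrite mul0r mulr0.
have [/= tx|//] := boolP (t <= x); last by rewrite mulr0 mulr0.
by move/negP : tax; rewrite inE/= in_itv/= at_ tx.
Qed.

Lemma integrable_kernel f (k : R -> R) : mu.-integrable setT (EFin \o f) ->
  measurable_fun [set: mR] k -> (forall t, `|k t| <= 1) ->
  mu.-integrable setT (EFin \o (fun t => f t * k t)).
Proof. by move=> fi mk k1; exact: integrableM_bounded fi. Qed.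

Lemma integrable_prim_kernel a f x : mu.-integrable setT (EFin \o f) ->
  mu.-integrable setT (EFin \o (fun t => f t * (step a t * step t x))).
Proof.
move=> fi; apply: integrable_kernel => //; last by move=> t; exact: norm_stepM_le1.
by apply: measurable_funM; apply: measurable_step.
Qed.

Lemma norm_prim_le a f x : mu.-integrable setT (EFin \o f) ->
  `|prim a f x| <= \int[mu]_t `|f t|.
Proof.
move=> fi; have ki := integrable_prim_kernel a x fi.
rewrite prim_kernel (le_trans (le_normr_Rintegral _ _))//.
apply: le_Rintegral => //; first exact: integrable_norm ki.
  exact: integrable_norm fi.
by move=> t _; rewrite normrM ler_piMr// norm_stepM_le1.
Qed.

Lemma measurable_prim_x a G : measurable_fun [set: mR * mR] G ->
  measurable_fun [set: mR * mR] (fun z => prim a (fun t => G (t, z.2)) z.1).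
Proof.
move=> mG.
pose K (w : mR * mR * mR) := G (w.2, w.1.2) * (step a w.2 * step w.2 w.1.1).
rewrite (_ : (fun z => _) = (fun z : mR * mR => \int[mu]_t K (z, t))); last first.
  by apply/funext => z; rewrite prim_kernel.
apply: (@measurable_Rintegral R _ (mR * mR)%type K).
have m2 : measurable_fun setT (fun w : mR * mR * mR => w.2) by exact: measurable_snd.
have m1 : measurable_fun setT (fun w : mR * mR * mR => w.1) by exact: measurable_fst.
have m11 : measurable_fun setT (fun w : mR * mR * mR => w.1.1).
  exact: measurableT_comp m1.
have m12 : measurable_fun setT (fun w : mR * mR * mR => w.1.2).
  exact: measurableT_comp m1.
apply: measurable_funM.
  by apply: (measurableT_comp mG); exact: measurable_fun_pair.
apply: measurable_funM; apply: measurable_step => //.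
Qed.

Lemma integrable_le_ae d (T : measurableType d)
    (nu : {measure set T -> \bar R}) (f g : T -> R) :
  measurable_fun setT f -> (\forall x \ae nu, `|f x| <= g x) ->
  nu.-integrable setT (EFin \o g) -> nu.-integrable setT (EFin \o f).
Proof.
move=> mf fg gi; have mg := integrableT_measurable gi.
have [_ glt] := integrableP _ _ _ gi.
apply/integrableP; split; first exact/measurable_EFinP.
apply: le_lt_trans glt; apply: ae_ge0_le_integral => //.
- by apply: measurableT_comp => //; exact/measurable_EFinP.
- by apply: measurableT_comp => //; exact/measurable_EFinP.
- apply: aeS fg => x fgx _ /=; rewrite lee_fin (le_trans fgx)// ler_norm.
  by [].
Qed.

Lemma Rintegral_eq0 d (T : measurableType d)
    (nu : {measure set T -> \bar R}) (D : set T) (f : T -> R) :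
  (forall x, D x -> f x = 0) -> \int[nu]_(x in D) f x = 0.
Proof. by move=> f0; rewrite /Rintegral integral0_eq// => x /f0 ->. Qed.

Lemma integrable_indic_itvcc (a b : R) :
  mu.-integrable setT (EFin \o (fun x => step a x * step x b)).
Proof.
have := integrable_indic_itv a b true false.
apply: eq_integrable => // x _ /=; rewrite indicE /step; congr EFin.
rewrite -natrM mulnb; congr (nat_of_bool _)%:R.
apply/idP/idP; first by rewrite inE/= in_itv.
by move=> h; rewrite mem_set//= in_itv.
Qed.

(** A primitive in [x] need not be integrable over the plane, as it may tend to a nonzero constant.
    Cut to [[a, b]] it is dominated by the indicator of [[a, b]] times the integral of [|G|] along
    the horizontal line. *)
Lemma integrable_prim_x a b G : mu2.-integrable setT (EFin \o G) ->
  mu2.-integrable setT (EFin \o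
    (fun z => step a z.1 * step z.1 b * prim a (fun t => G (t, z.2)) z.1)).
Proof.
move=> Gi; have mG := integrable_measurable Gi.
have Ni : mu2.-integrable setT (EFin \o (fun z => `|G z|)) by exact: integrable_norm Gi.
apply: (integrable_le_ae _ _ (integrable_tensor (integrable_indic_itvcc a b)
  (integrable_Rintegral_y Ni))).
  apply: measurable_funM; last exact: measurable_prim_x.
  apply: (@measurable_funM _ (mR * mR)%type).
    by apply: (@measurable_step _ (mR * mR)%type (fun _ => a) fst) => //; exact: measurable_fst.
  by apply: (@measurable_step _ (mR * mR)%type fst (fun _ => b)) => //; exact: measurable_fst.
have := ae_snd (ae_integrable_y Gi); apply: aeS => -[x y] /= Gy.
have /andP[h0 h1] := step_ge0_le1 a x; have /andP[k0 k1] := step_ge0_le1 x b.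
rewrite /tensor/= normrM ger0_norm ?mulr_ge0// ler_wpM2l ?mulr_ge0//.
exact: norm_prim_le.
Qed.

(** Fubini on the region [a <= t <= x]. It gives both integration by parts and the collapse of a
    repeated primitive into one with kernel [x - t]. *)
Lemma triangle a f g : mu.-integrable setT (EFin \o f) ->
  mu.-integrable setT (EFin \o g) ->
  \int[mu]_x (f x * prim a g x) =
  \int[mu]_t (g t * step a t * \int[mu]_x (f x * step t x)).
Proof.
move=> fi gi.
pose K (z : R * R) := tensor f g z * (step a z.2 * step z.2 z.1).
have Ki : mu2.-integrable setT (EFin \o K).
  apply: (@integrableM_bounded _ _ mu2 _ _ 1).
  - apply: (@measurable_funM _ (mR * mR)%type).
      by apply: (@measurable_step _ (mR * mR)%type (fun _ => a) snd) => //; exact: measurable_snd.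
    by apply: (@measurable_step _ (mR * mR)%type snd fst); [exact: measurable_snd|exact: measurable_fst].
  - by move=> z; exact: norm_stepM_le1.
  - exact: integrable_tensor.
transitivity (\int[mu]_x \int[mu]_t K (x, t)).
  apply: eq_Rintegral => x _; rewrite prim_kernel -RintegralZl//.
    by apply: eq_Rintegral => t _; rewrite /K /tensor/= mulrA.
  exact: integrable_prim_kernel.
rewrite -(Rfubini_xy Ki) (Rfubini_yx Ki); apply: eq_Rintegral => t _.
rewrite -RintegralZl//.
  by apply: eq_Rintegral => x _; rewrite /K /tensor/=; ring.
apply: integrable_kernel => // [|x]; first exact: measurable_step.
by have /andP[? ?] := step_ge0_le1 t x; rewrite ger0_norm.
Qed.

Lemma smooth_measurable f : smooth f -> measurable_fun [set: mR] f.
Proof. by move=> sf; apply: continuous_measurable_fun; exact: smooth_continuous. Qed.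

Lemma test1_integrable (a b : R) f : test1 a b f -> mu.-integrable setT (EFin \o f).
Proof.
move=> [sf [s [t [sa tb f0]]]].
have : mu.-integrable `[s, t] (EFin \o f).
  apply: continuous_compact_integrable; first exact: segment_compact.
  by apply: continuous_subspaceT; exact: smooth_continuous.
move=> /(integrable_mkcond _ _).1 /= => /(_ (measurable_itv _)).
apply: eq_integrable => // x _; rewrite patchE; case: ifPn => //.
by move=> xst; rewrite /= f0//; apply: contra xst => h; rewrite inE.
Qed.

Lemma test1_bounded (a b : R) f : test1 a b f -> exists M : R, forall x, `|f x| <= M.
Proof.
move=> [sf [s [t [sa tb f0]]]].
have [st|ts] := leP s t; last first.
  by exists 0 => x; rewrite f0 ?normr0// in_itv/=; apply/negP => /andP[sx /(le_trans sx)]; rewrite leNgt ts.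
have cf : {within `[s, t], continuous (fun x => `|f x|)}.
  apply: continuous_subspaceT => x; apply: (@continuous_comp _ _ _ f (Num.norm : R -> R)); last exact: norm_continuous.
  exact: smooth_continuous.
have [c _ fc] := EVT_max st cf.
exists (Num.max 0 `|f c|) => x; rewrite le_max; have [xst|/f0 ->] := boolP (x \in `[s, t]).
  by rewrite fc// orbT.
by rewrite normr0 lexx.
Qed.

(** The primitive taken from minus infinity vanishes to the left of the support trivially, and to
    the right of it because the total integral is 0. *)
Lemma test1_primitive (a b : R) f : test1 a b f -> \int[mu]_x f x = 0 ->
  exists2 F, test1 a b F & derive1 F = f.
Proof.
move=> tf f0; have fi := test1_integrable tf.
have [sf [s [t [sa tb fst]]]] := tf.
pose F x := \int[mu]_(y in [set` Interval -oo%O (BRight x)]) f y.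
have FD x : derivable F x 1 /\ derive1 F x = f x.
  apply: (@continuous_FTC1 R f -oo%O x (x + 1)); rewrite ?ltrDl//.
  - by apply: integrableS fi => //; exact: measurable_itv.
  - by rewrite ltNyr.
  - exact: smooth_continuous.
have dF : derive1 F = f by apply/funext => x; have [] := FD x.
exists F => //; split.
  have isF (x : R) : is_derive x 1 F (f x).
    by have [dFx <-] := FD x; rewrite derive1E; exact/derivableP.
  move=> [|n]; first exact/ck0/(is_derive_continuous isF).
  exact: (ckS isF (sf n)).
exists s, t; split=> // x; rewrite in_itv/= negb_and -!ltNge => /orP[xs|tx].
  apply: Rintegral_eq0 => y; rewrite /= in_itv/= => yx; apply: fst.
  by rewrite in_itv/= negb_and -!ltNge (le_lt_trans yx xs).
rewrite -[RHS]f0 /F Rintegral_mkcond; apply: eq_Rintegral => y _.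
rewrite patchE; case: ifPn => // /negP yx; apply/esym/fst.
rewrite in_itv/= negb_and -!ltNge; apply/orP; right.
rewrite (lt_trans tx)// ltNge; apply/negP => yx'; apply: yx.
by rewrite inE/= in_itv.
Qed.

End primitives.

(** The sets over which [f] integrates to 0 form a Dynkin system; closure under complement is where
    the vanishing of the total integral enters. So [f] integrates to 0 over every measurable set,
    hence is 0 almost everywhere. *)
Lemma ae_eq0_pi_system d (T : measurableType d) (R : realType)
    (nu : {measure set T -> \bar R}) (G : set (set T)) (f : T -> R) :
  @measurable _ T = <<s G >> -> setI_closed G ->
  nu.-integrable setT (EFin \o f) -> \int[nu]_x f x = 0 ->
  (forall A, G A -> \int[nu]_(x in A) f x = 0) ->
  \forall x \ae nu, f x = 0.
Proof.
move=> mG GI fi f0 fG.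
have fiS S : measurable S -> nu.-integrable S (EFin \o f).
  by move=> mS; exact: integrableS fi.
have fS S : measurable S -> \int[nu]_(x in S) f x = 0.
  rewrite mG; move: S; apply: (dynkin_induction mG) => //.
  - move=> S mS fS0.
    have := @Rintegral_setU _ _ _ nu S (~` S) f mS (measurableC mS).
    rewrite setUv f0 fS0 add0r => <-//.
    by apply/disj_setPS; rewrite setICr.
  - move=> F mF tF F0; rewrite /Rintegral integral_bigcup//; last first.
      by apply: fiS; exact: bigcupT_measurable.
    rewrite eseries0// => i _ _ /=.
    have := F0 i; rewrite /Rintegral => Fi.
    by rewrite -[LHS]fineK ?Fi//; apply: integrable_fin_num => //; exact: fiS.
have := @integral_ae_eq _ _ _ nu setT measurableT (cst 0%E) (EFin \o f) fi.
have H : measurable_fun setT (cst 0%E : T -> \bar R) by [].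
move=> /(_ H) {}H.
have : ae_eq nu setT (EFin \o f) (cst 0%E).
  apply: H => E _ mE; rewrite integral0.
  rewrite -[LHS]fineK; first by have := fS E mE; rewrite /Rintegral => ->.
  by apply: integrable_fin_num => //; exact: fiS.
by apply: aeS => x /= /(_ I) [].
Qed.

Lemma Rintegral_indic d (T : measurableType d) (R : realType)
    (nu : {measure set T -> \bar R}) (D : set T) (f : T -> R) :
  \int[nu]_(x in D) f x = \int[nu]_x (f x * \1_D x).
Proof.
rewrite Rintegral_mkcond; apply: eq_Rintegral => x _.
by rewrite patchE indicE; case: (x \in D); rewrite ?mulr1 ?mulr0.
Qed.

(** * The fundamental lemma of the calculus of variations, on an interval and on a rectangle *)

Section fundamental_lemma.
Context {R : realType}.
Local Notation mu := (@lebesgue_measure R).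
Local Notation mu2 := (mu \x mu)%E.
Local Notation mR := (measurableTypeR R).
Implicit Types (f g : R -> R) (F G : R * R -> R).

(** The bumps converge to the indicator of []s, t[] with values in [[0, 1]], so dominated
    convergence applies with bound [|f|]. *)
Lemma test1_indic_itvoo (a b s t : R) f : a <= s -> t <= b ->
  mu.-integrable setT (EFin \o f) ->
  (forall phi, test1 a b phi -> \int[mu]_x (f x * phi x) = 0) ->
  \int[mu]_(x in `]s, t[) f x = 0.
Proof.
move=> as_ tb fi ftest.
have mf : measurable_fun [set: mR] f by exact: integrableT_measurable fi.
have mb n : measurable_fun [set: mR] (bump n s t).
  by apply: smooth_measurable; exact: smooth_bump.
have mi : measurable_fun [set: mR] (\1_`]s, t[%classic : R -> R).
  by apply: measurable_indic.
have [_ _] : [/\ mu.-integrable setT (fun x => (f x * \1_`]s, t[%classic x)%:E),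
    [sequence \int[mu]_x `|(f x * bump n.+1 s t x)%:E - (f x * \1_`]s, t[%classic x)%:E|]_n%E @ \oo --> 0%E &
    [sequence \int[mu]_x (f x * bump n.+1 s t x)%:E]_n%E @ \oo -->
      (\int[mu]_x (f x * \1_`]s, t[%classic x)%:E)%E].
  apply: (@dominated_convergence _ _ _ mu setT measurableT
    (fun n x => (f x * bump n.+1 s t x)%:E) _ (fun x => (`|f x|)%:E)).
  - by move=> n; apply/measurable_EFinP; exact: measurable_funM.
  - by apply/measurable_EFinP; exact: measurable_funM.
  - apply/aeW => x _; apply: cvg_EFin; first exact: nearW.
    by apply: cvgMr; exact: bump_cvg.
  - exact: integrable_norm.
  - apply/aeW => x n _; rewrite lee_fin normrM ler_piMr//.
    by have /andP[? ?] := bump_ge0_le1 n.+1 s t x; rewrite ger0_norm.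
have bi n : mu.-integrable setT (EFin \o (fun x => f x * bump n.+1 s t x)).
  apply: integrable_kernel => // x.
  by have /andP[? ?] := bump_ge0_le1 n.+1 s t x; rewrite ger0_norm.
rewrite [X in X @ _ --> _](_ : _ = cst 0%E); last first.
  apply/funext => n /=; rewrite -[LHS]fineK; last exact: integrable_fin_num (bi n).
  by congr EFin; apply: ftest; exact: test1_bump.
move=> /cvg_lim; rewrite lim_cst// => /(_ (@ereal_hausdorff _)) H.
by rewrite Rintegral_indic /Rintegral -H.
Qed.

Lemma fundamental_lemma1 (a b : R) f : mu.-integrable setT (EFin \o f) ->
  (forall phi, test1 a b phi -> \int[mu]_x (f x * phi x) = 0) ->
  \forall x \ae mu, x \in `]a, b[ -> f x = 0.
Proof.
move=> fi ftest; have foo s t (as_ : a <= s) (tb : t <= b) :=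
  test1_indic_itvoo as_ tb fi ftest.
have : \forall x \ae mu, f x * \1_`]a, b[%classic x = 0.
  apply: (@ae_eq0_pi_system _ mR R mu (@RGenOpens.G R)
    (fun x => f x * \1_`]a, b[%classic x)).
  - exact: RGenOpens.measurableE.
  - move=> _ _ [x [y ->]] [x' [y' ->]]; exists (Num.max x x'), (Num.min y y').
    apply/seteqP; split=> z /=; rewrite !in_itv/= gt_max lt_min.
      by move=> [/andP[-> ->] /andP[-> ->]].
    by move=> /andP[/andP[-> ->] /andP[-> ->]].
  - apply: (@integrable_kernel _ f (\1_`]a, b[%classic)) => //.
    by move=> t; rewrite indicE; case: (t \in _); rewrite ?normr1 ?normr0.
  - by rewrite -Rintegral_indic foo.
  - move=> _ [x [y ->]].
    (* The intersection of []x, y[] with []a, b[] is again an open interval, now with ends inside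
       [[a, b]], or empty. *)
    transitivity (\int[mu]_(t in `]Num.max x a, Num.min y b[) f t).
      rewrite Rintegral_indic [RHS]Rintegral_indic; apply: eq_Rintegral => t _.
      rewrite -mulrA !indicE -natrM mulnb; congr (_ * (nat_of_bool _)%:R).
      apply/andP/idP => [[]|]; rewrite !inE/= !in_itv/= gt_max lt_min.
        by move=> /andP[-> ->] /andP[-> ->].
      by move=> /andP[/andP[-> ->] /andP[-> ->]].
    by apply: foo; rewrite ?le_max ?ge_min lexx orbT.
by apply: aeS => x; rewrite indicE => + xab; rewrite mem_set// mulr1.
Qed.

Lemma ae_eq_Rintegral d (T : measurableType d) (nu : {measure set T -> \bar R})
    (f g : T -> R) :
  measurable_fun setT f -> measurable_fun setT g ->
  (\forall x \ae nu, f x = g x) -> \int[nu]_x f x = \int[nu]_x g x.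
Proof.
move=> mf mg fg; congr fine; apply: ae_eq_integral => //; try exact/measurable_EFinP.
by apply: aeS fg => x fgx _; rewrite fgx.
Qed.

Lemma measurable_fst_comp f : measurable_fun [set: mR] f ->
  measurable_fun [set: mR * mR] (fun z : mR * mR => f z.1).
Proof. by move=> mf; apply: (measurableT_comp mf); exact: measurable_fst. Qed.

Lemma measurable_snd_comp f : measurable_fun [set: mR] f ->
  measurable_fun [set: mR * mR] (fun z : mR * mR => f z.2).
Proof. by move=> mf; apply: (measurableT_comp mf); exact: measurable_snd. Qed.

Lemma integrableM_fst F f (M : R) : mu2.-integrable setT (EFin \o F) ->
  measurable_fun [set: mR] f -> (forall x, `|f x| <= M) ->
  mu2.-integrable setT (EFin \o (fun z => F z * f z.1)).
Proof.
move=> Fi mf fM; apply: (@integrableM_bounded R _ _ mu2 F (fun z => f z.1) M) => //.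
exact: measurable_fst_comp.
Qed.

Lemma integrableM_snd F f (M : R) : mu2.-integrable setT (EFin \o F) ->
  measurable_fun [set: mR] f -> (forall x, `|f x| <= M) ->
  mu2.-integrable setT (EFin \o (fun z => F z * f z.2)).
Proof.
move=> Fi mf fM; apply: (@integrableM_bounded R _ _ mu2 F (fun z => f z.2) M) => //.
exact: measurable_snd_comp.
Qed.

Lemma integrableM_tensor F (k l : R -> R) (M N : R) :
  mu2.-integrable setT (EFin \o F) ->
  measurable_fun [set: mR] k -> (forall x, `|k x| <= M) ->
  measurable_fun [set: mR] l -> (forall x, `|l x| <= N) ->
  mu2.-integrable setT (EFin \o (fun z => F z * tensor k l z)).
Proof.
move=> Fi mk kM ml lN.
have := integrableM_snd (integrableM_fst Fi mk kM) ml lN.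
by apply: eq_integrable => // z _; rewrite /tensor /= mulrA.
Qed.

Lemma Rfubini_tensor F (k l : R -> R) (M N : R) : mu2.-integrable setT (EFin \o F) ->
  measurable_fun [set: mR] k -> (forall x, `|k x| <= M) ->
  measurable_fun [set: mR] l -> (forall x, `|l x| <= N) ->
  \int[mu2]_z (F z * tensor k l z) =
  \int[mu]_x ((\int[mu]_y (F (x, y) * l y)) * k x).
Proof.
move=> Fi mk kM ml lN; have Fli := integrableM_snd Fi ml lN.
have Flki := integrableM_fst Fli mk kM.
rewrite (_ : (fun z => _) = (fun z => F z * l z.2 * k z.1)); last first.
  by apply/funext => z; rewrite /tensor; ring.
rewrite (Rfubini_xy Flki); apply: ae_eq_Rintegral.
- exact: integrableT_measurable (integrable_Rintegral_x Flki).
- apply: measurable_funM => //.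
  exact: integrableT_measurable (integrable_Rintegral_x Fli).
- by apply: aeS (ae_integrable_x Fli) => x Flx;
    exact: (@RintegralZr _ _ R mu setT (fun y => F (x, y) * l y) (k x) measurableT Flx).
Qed.

Lemma Rfubini_tensor_swap F (k l : R -> R) (M N : R) : mu2.-integrable setT (EFin \o F) ->
  measurable_fun [set: mR] k -> (forall x, `|k x| <= M) ->
  measurable_fun [set: mR] l -> (forall x, `|l x| <= N) ->
  \int[mu2]_z (F z * tensor k l z) =
  \int[mu]_y ((\int[mu]_x (F (x, y) * k x)) * l y).
Proof.
move=> Fi mk kM ml lN.
rewrite -(Rfubini_tensor (integrable_swap Fi) ml lN mk kM).
rewrite -(Rintegral_swap (integrableM_tensor Fi mk kM ml lN)).
by apply: eq_Rintegral => z _; rewrite /tensor/=; ring.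
Qed.

Lemma norm_indic_le1 (A : set R) x : `|\1_A x : R| <= 1.
Proof. by rewrite indicE; case: (x \in A); rewrite /= ?normr1 ?normr0. Qed.

(** One factor at a time. With [psi] fixed, the one-dimensional lemma shows that the integral of [F]
    against [psi] in [y] vanishes for almost every [x] in []a, b[], so [phi] may be replaced by the
    indicator of any measurable part of []a, b[] ([H]). The same in the other variable ([K]) reaches
    measurable rectangles, a generating pi-system. *)
Lemma fundamental_lemma2 (a b c d : R) F : mu2.-integrable setT (EFin \o F) ->
  (forall phi psi, test1 a b phi -> test1 c d psi ->
    \int[mu2]_z (F z * tensor phi psi z) = 0) ->
  \forall z \ae mu2, orect a b c d z -> F z = 0.
Proof.
move=> Fi Ftest; have mF := integrable_measurable Fi.
have mI (A : set mR) (s t : R) : measurable A ->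
    measurable_fun [set: mR] (\1_(A `&` `]s, t[%classic) : R -> R).
  by move=> mA; apply: measurable_indic; exact: measurableI.
have H (A : set mR) psi : measurable A -> test1 c d psi ->
    \int[mu2]_z (F z * tensor \1_(A `&` `]a, b[%classic) psi z) = 0.
  move=> mA tpsi; have [N psiN] := test1_bounded tpsi.
  have mpsi := smooth_measurable tpsi.1.
  have gi := integrable_Rintegral_x (integrableM_snd Fi mpsi psiN).
  rewrite (Rfubini_tensor Fi (mI A a b mA) (norm_indic_le1 _) mpsi psiN).
  transitivity (\int[mu]_x (0 : R)); last by rewrite Rintegral_eq0.
  apply: ae_eq_Rintegral => //.
    apply: measurable_funM; last exact: mI.
    exact: integrableT_measurable gi.
  apply: aeS (@fundamental_lemma1 a b _ gi _) => [x gx|phi tphi].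
    rewrite indicE; have [|_] := boolP (x \in _); last by rewrite mulr0.
    by rewrite inE => -[_ /= xab]; rewrite /= gx// mul0r.
  have [M phiM] := test1_bounded tphi.
  by rewrite -(Rfubini_tensor Fi (smooth_measurable tphi.1) phiM mpsi psiN) Ftest.
have K (A B : set mR) : measurable A -> measurable B ->
    \int[mu2]_z (F z * tensor \1_(A `&` `]a, b[%classic) \1_(B `&` `]c, d[%classic) z) = 0.
  move=> mA mB.
  have hi := integrable_Rintegral_y (integrableM_fst Fi (mI A a b mA) (norm_indic_le1 _)).
  rewrite (Rfubini_tensor_swap Fi (mI A a b mA) (norm_indic_le1 _) (mI B c d mB) (norm_indic_le1 _)).
  transitivity (\int[mu]_x (0 : R)); last by rewrite Rintegral_eq0.
  apply: ae_eq_Rintegral => //.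
    apply: measurable_funM; last exact: mI.
    exact: integrableT_measurable hi.
  apply: aeS (@fundamental_lemma1 c d _ hi _) => [x hx|phi tphi].
    rewrite indicE; have [|_] := boolP (x \in _); last by rewrite mulr0.
    by rewrite inE => -[_ /= xab]; rewrite /= hx// mul0r.
  have [M phiM] := test1_bounded tphi.
  by rewrite -(Rfubini_tensor_swap Fi (mI A a b mA) (norm_indic_le1 _) (smooth_measurable tphi.1) phiM) H.
have S : \forall z \ae mu2, F z * tensor \1_(`]a, b[%classic) \1_(`]c, d[%classic) z = 0.
  have E A B z : F z * tensor \1_(`]a, b[%classic) \1_(`]c, d[%classic) z * \1_(A `*` B) z =
      F z * tensor \1_(A `&` `]a, b[%classic) \1_(B `&` `]c, d[%classic) z.
    case: z => x y; rewrite -mulrA; congr (_ * _); rewrite /tensor/= !indicE -!natrM !mulnb.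
    congr (nat_of_bool _)%:R; rewrite classical_sets.in_setX !classical_sets.in_setI/=.
    by rewrite andbC andbACA.
  apply: (@ae_eq0_pi_system _ (mR * mR)%type R mu2 _
    (fun z => F z * tensor \1_(`]a, b[%classic) \1_(`]c, d[%classic) z)).
  - exact: measurable_prod_measurableType.
  - move=> _ _ [A1 mA1 [A2 mA2 <-]] [B1 mB1 [B2 mB2 <-]].
    exists (A1 `&` B1); first exact: measurableI.
    by exists (A2 `&` B2); [exact: measurableI|rewrite setXI].
  - apply: (integrableM_tensor Fi _ (norm_indic_le1 _) _ (norm_indic_le1 _));
      exact: measurable_indic.
  - by have := K _ _ measurableT measurableT; rewrite !setTI.
  - move=> _ [A mA [B mB <-]]; rewrite Rintegral_indic -[RHS](K A B)//.
    by apply: eq_Rintegral => z _; rewrite E.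
apply: aeS S => -[x y] + [/= xab ycd]; rewrite /tensor/= !indicE.
by rewrite !mem_set//= !mulr1.
Qed.
End fundamental_lemma.

(** * A weak derivative in one variable is inverted by a primitive *)

Section weak_primitive.
Context {R : realType}.
Local Notation mu := (@lebesgue_measure R).
Local Notation mu2 := (mu \x mu)%E.
Local Notation mR := (measurableTypeR R).
Implicit Types (f g : R -> R) (F G : R * R -> R).

Lemma ae_neq (a : R) : \forall x \ae mu, x != a.
Proof.
exists [set a]; split=> //; first exact: lebesgue_measure_set1.
by move=> x /= /negP; rewrite negbK => /eqP.
Qed.

(** Test functions see only the open rectangle, while the claims concern the closed one; the
    boundary lies on four lines, which are null. *)
Lemma ae_rect_orect (a b c d : R) :
  \forall z \ae mu2, rect a b c d z -> orect a b c d z.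
Proof.
have := aeI (aeI (ae_fst (ae_neq a)) (ae_fst (ae_neq b)))
  (aeI (ae_snd (ae_neq c)) (ae_snd (ae_neq d))).
apply: aeS => -[x y] /= [[xa xb] [yc yd]] [/=]; rewrite !in_itv/= => /andP[ax xb'] /andP[cy yd'].
by split; rewrite /= in_itv/= !lt_neqAle ?ax ?cy ?xb' ?yd' ?xb ?yd 1?eq_sym ?xa ?yc.
Qed.

(** If every test function had integral 0, the fundamental lemma applied to the indicator of []a,
    b[] would give 1 = 0 almost everywhere on an interval of positive length. No integral of a bump
    has to be computed. *)
Lemma exists_test1_integral1 (a b : R) : a < b ->
  exists2 omega, test1 a b omega & \int[mu]_x omega x = 1.
Proof.
move=> ab.
have [[phi [tphi phi0]]|H] := pselect (exists phi, test1 a b phi /\ \int[mu]_x phi x != 0).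
  exists (fun x => (\int[mu]_x phi x)^-1 * phi x); first exact: test1Z.
  by rewrite RintegralZl ?mulVf//; exact: test1_integrable tphi.
exfalso.
have i1 := @integrable_indic_itv R a b false true.
have [N [mN N0 sN]] : \forall x \ae mu, x \in `]a, b[ -> \1_`]a, b[%classic x = 0 :> R.
  apply: (fundamental_lemma1 i1) => phi tphi.
  rewrite (@eq_Rintegral _ _ _ mu setT phi).
    by apply: contrapT => /eqP p0; apply: H; exists phi.
  move=> x _; rewrite indicE; have [xab|xab] := boolP (x \in `]a, b[).
    by rewrite mem_set// mul1r.
  by rewrite (test1_eq0 tphi xab) mulr0.
have : (mu `]a, b[%classic <= mu N)%E.
  apply: le_measure; rewrite ?inE//.
  move=> x /= xab; apply: sN => /= /(_ xab); rewrite indicE mem_set//.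
  by move/eqP; rewrite oner_eq0.
by rewrite lebesgue_measure_itv/= lte_fin ab N0 -EFinD lee_fin subr_le0 leNgt ab.
Qed.

(** By [triangle], [g t] gets multiplied by the integral of the derivative of [f] from [t] onwards,
    which is [- f t]. *)
Lemma integration_by_parts_test1 (a b : R) f g : test1 a b f ->
  mu.-integrable setT (EFin \o g) ->
  \int[mu]_x (prim a g x * derive1 f x) = - \int[mu]_x (g x * f x).
Proof.
move=> tf gi; have tf' := test1_derive1 tf.
under eq_Rintegral do rewrite mulrC.
rewrite (triangle a (test1_integrable tf') gi) -mulN1r -RintegralZl//; last first.
  have [M fM] := test1_bounded tf.
  apply: (@integrableM_bounded R _ mR mu g f M) => //.
  exact: smooth_measurable tf.1.
apply: eq_Rintegral => t _.
have -> : \int[mu]_x (derive1 f x * step t x) = - f t.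
  (* A point beyond both [t] and the support of [f], where the half-line is cut so that the
     fundamental theorem on a segment applies. *)
  pose B := Num.max b t + 1.
  have tB : t < B by rewrite ltr_pwDr// le_max lexx orbT.
  have fB : f B = 0.
    by apply: (test1_eq0 tf); rewrite in_itv/= negb_and -!leNgt (_ : b <= B) ?orbT// ler_wpDr// le_max lexx.
  transitivity (\int[mu]_(x in `[t, B]) derive1 f x).
    rewrite [RHS]Rintegral_indic; apply: eq_Rintegral => x _.
    have [Bx|xB] := ltP B x.
      rewrite (test1_eq0 tf') ?mul0r//.
      rewrite in_itv/= negb_and -!leNgt (_ : b <= x) ?orbT//.
      by rewrite (le_trans _ (ltW Bx))// ler_wpDr// le_max lexx.
    congr (_ * _); rewrite indicE /step; congr (nat_of_bool _)%:R.
    by apply/idP/idP => [tx|]; rewrite inE/= in_itv/= ?tx// => /andP[].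
  rewrite /Rintegral (@continuous_FTC2 _ _ f)//=; first by rewrite fB add0r.
  - by apply: continuous_subspaceT; exact: smooth_continuous tf'.1.
  - split=> [x _||].
    + exact: smooth_derivable tf.1.
    + exact: cvg_at_right_filter (smooth_continuous tf.1 (x := t)).
    + exact: cvg_at_left_filter (smooth_continuous tf.1 (x := B)).
rewrite mulN1r mulrN; congr (- _); rewrite /step.
(* For [t < a] the factor [step a t] is 0, but so is [f t]. *)
have [at_|ta] := leP a t; first by rewrite mulr1.
rewrite (test1_eq0 tf) ?mulr0// in_itv/= negb_and -!leNgt (ltW ta)//.
Qed.

Lemma test1B (a b : R) f g :
  test1 a b f -> test1 a b g -> test1 a b (fun x => f x - g x).
Proof.
move=> tf tg; have := test1D tf (test1Z (-1) tg).
by congr test1; apply/funext => x; rewrite mulN1r.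
Qed.

(* Let [G] be the [x]-primitive of [g] and [D = F - G]; then [D] is annihilated
   by [phi' psi]. Every test function of integral [0] is a [phi'], so [D] acts on
   [beta psi] as [(\int beta) D (omega psi)] with [\int omega = 1], that is,
   like the function [r y = \int D x y omega x dx] of [y] alone. *)
Lemma weak_deriv_x_primitive (a b c d : R) (F g : R * R -> R) : a < b ->
  mu2.-integrable setT (EFin \o F) -> mu2.-integrable setT (EFin \o g) ->
  (forall phi psi, test1 a b phi -> test1 c d psi ->
    \int[mu2]_z (F z * tensor (derive1 phi) psi z) =
    - \int[mu2]_z (g z * tensor phi psi z)) ->
  exists2 r, mu.-integrable setT (EFin \o r) &
    \forall z \ae mu2, rect a b c d z ->
      F z = r z.2 + prim a (fun t => g (t, z.2)) z.1.
Proof.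
move=> ab Fi gi Fg.
have tb phi (u v : R) : test1 u v phi -> exists M : R, forall x, `|phi x| <= M.
  exact: test1_bounded.
have mt phi (u v : R) : test1 u v phi -> measurable_fun [set: mR] phi.
  by move=> tphi; exact: smooth_measurable tphi.1.
have iT H phi psi : mu2.-integrable setT (EFin \o H) -> test1 a b phi -> test1 c d psi ->
    mu2.-integrable setT (EFin \o (fun z => H z * tensor phi psi z)).
  move=> Hi tphi tpsi; have [M pM] := tb _ _ _ tphi; have [N pN] := tb _ _ _ tpsi.
  exact: integrableM_tensor (mt _ _ _ tphi) pM (mt _ _ _ tpsi) pN.
have fubx H phi psi : mu2.-integrable setT (EFin \o H) -> test1 a b phi -> test1 c d psi ->
    \int[mu2]_z (H z * tensor phi psi z) = \int[mu]_y ((\int[mu]_x (H (x, y) * phi x)) * psi y).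
  move=> Hi tphi tpsi; have [M pM] := tb _ _ _ tphi; have [N pN] := tb _ _ _ tpsi.
  exact: Rfubini_tensor_swap (mt _ _ _ tphi) pM (mt _ _ _ tpsi) pN.
have yi H phi psi : mu2.-integrable setT (EFin \o H) -> test1 a b phi -> test1 c d psi ->
    mu.-integrable setT (EFin \o (fun y => (\int[mu]_x (H (x, y) * phi x)) * psi y)).
  move=> Hi tphi tpsi; have [M pM] := tb _ _ _ tphi; have [N pN] := tb _ _ _ tpsi.
  apply: (@integrableM_bounded R _ mR mu _ _ N) => //; first exact: mt tpsi.
  apply: (@integrable_Rintegral_y R (fun z => H z * phi z.1)).
  exact: integrableM_fst Hi (mt _ _ _ tphi) pM.
(* The cut to [[a, b]] makes [G] integrable over the plane; test functions on []a, b[] do not see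
   it. *)
pose G z := step a z.1 * step z.1 b * prim a (fun t => g (t, z.2)) z.1.
have Gi : mu2.-integrable setT (EFin \o G) by exact: integrable_prim_x.
have Gtest phi psi : test1 a b phi -> test1 c d psi ->
    \int[mu2]_z (G z * tensor (derive1 phi) psi z) = - \int[mu2]_z (g z * tensor phi psi z).
  move=> tphi tpsi; have tphi' := test1_derive1 tphi.
  rewrite !fubx// -mulN1r -RintegralZl//; last exact: yi.
  apply: ae_eq_Rintegral.
  - exact: integrableT_measurable (yi _ _ _ Gi tphi' tpsi).
  - apply: measurable_funM => //; exact: integrableT_measurable (yi _ _ _ gi tphi tpsi).
  apply: aeS (ae_integrable_y gi) => y giy.
  rewrite mulN1r -mulNr; congr (_ * _).
  rewrite -(integration_by_parts_test1 tphi giy); apply: eq_Rintegral => x _.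
  rewrite /G /= /step; have [xab|xab] := boolP (x \in `]a, b[).
    by move: xab; rewrite in_itv/= => /andP[/ltW -> /ltW ->]; rewrite !mul1r.
  by rewrite (test1_eq0 tphi' xab) !mulr0.
pose D z := F z - G z.
have Di : mu2.-integrable setT (EFin \o D).
  have := integrableB measurableT Fi Gi.
  by apply: eq_integrable => // z _.
have D0 eta psi : test1 a b eta -> \int[mu]_x eta x = 0 -> test1 c d psi ->
    \int[mu2]_z (D z * tensor eta psi z) = 0.
  move=> teta eta0 tpsi; have [phi tphi phi'] := test1_primitive teta eta0.
  under eq_Rintegral do rewrite /D mulrBl.
  rewrite RintegralB//; [|exact: iT|exact: iT].
  by rewrite -phi' Fg// Gtest// subrr.
have [omega tomega omega1] := exists_test1_integral1 ab.
pose r y := \int[mu]_x (D (x, y) * omega x).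
have [M omegaM] := tb _ _ _ tomega.
have ri : mu.-integrable setT (EFin \o r).
  apply: (@integrable_Rintegral_y R (fun z => D z * omega z.1)).
  exact: integrableM_fst Di (mt _ _ _ tomega) omegaM.
exists r => //.
(* [r], as a function of [y] alone, is again cut to [[a, b]] in [x] to be integrable over the
   plane. *)
pose E z := D z - tensor (fun x => step a x * step x b) r z.
have Ti := integrable_tensor (integrable_indic_itvcc a b) ri.
have Ei : mu2.-integrable setT (EFin \o E).
  have := integrableB measurableT Di Ti.
  by apply: eq_integrable => // z _.
have : \forall z \ae mu2, orect a b c d z -> E z = 0.
  apply: fundamental_lemma2 => // beta psi tbeta tpsi.
  under eq_Rintegral do rewrite /E mulrBl.
  rewrite RintegralB//; [|exact: iT|exact: iT].
  have -> : \int[mu2]_z (tensor (fun x => step a x * step x b) r z * tensor beta psi z) =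
      (\int[mu]_x beta x) * \int[mu2]_z (D z * tensor omega psi z).
    rewrite !fubx// -RintegralZl//; last exact: yi.
    apply: eq_Rintegral => y _; rewrite mulrA; congr (_ * _); rewrite -/(r y).
    rewrite -RintegralZr//; last exact: test1_integrable tbeta.
    apply: eq_Rintegral => x _; rewrite /tensor/= mulrAC; congr (_ * _).
    rewrite /step; have [xab|xab] := boolP (x \in `]a, b[).
      by move: xab; rewrite in_itv/= => /andP[/ltW -> /ltW ->]; rewrite !mul1r.
    by rewrite (test1_eq0 tbeta xab) !mulr0.
  rewrite -RintegralZl//; last exact: iT.
  rewrite -RintegralB//; last 2 first.
    exact: iT.
    have := integrableZl measurableT (\int[mu]_x beta x) (iT _ _ _ Di tomega tpsi).
    by apply: eq_integrable => // z _; rewrite /= EFinM.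
  rewrite -[RHS](D0 (fun x => beta x - (\int[mu]_x beta x) * omega x) psi)//.
  - by apply: eq_Rintegral => z _; rewrite /tensor; ring.
  - by apply: test1B => //; exact: test1Z.
  - rewrite RintegralB//; [|exact: test1_integrable tbeta|].
      rewrite RintegralZl//; last exact: test1_integrable tomega.
      by rewrite omega1 mulr1 subrr.
    exact: test1_integrable (test1Z _ tomega).
move=> /aeI /(_ (ae_rect_orect a b c d)); apply: aeS => -[x y] [E0 ro] xy.
have := E0 (ro xy); have [/= xab _] := ro xy.
rewrite /E /D /G /tensor /step/=; move: xab; rewrite /= in_itv/= => /andP[/ltW -> /ltW ->].
by rewrite !mul1r => /eqP; rewrite subr_eq0 subr_eq => /eqP.
Qed.

End weak_primitive.

(** * Two successive weak derivatives, one in each variable *)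

Section mixed_primitive.
Context {R : realType}.
Local Notation mu := (@lebesgue_measure R).
Local Notation mu2 := (mu \x mu)%E.
Local Notation mR := (measurableTypeR R).
Local Notation swap := (@unstable.swap R R).
Implicit Types (f g p : R -> R) (F G W : R * R -> R).

(* [is_weak_deriv], tested on tensor products only, for functions that vanish
   outside the rectangle. *)
Definition weak_tensor (a b c d : R) (i j : nat) F G :=
  forall phi psi, test1 a b phi -> test1 c d psi ->
    \int[mu2]_z (F z * tensor (iter i (@derive1 R R) phi) (iter j (@derive1 R R) psi) z) =
    (-1) ^+ (i + j) * \int[mu2]_z (G z * tensor phi psi z).

Lemma test1_iter_derive1 (a b : R) i f : test1 a b f ->
  test1 a b (iter i (@derive1 R R) f).
Proof. by move=> tf; elim: i => //= i; exact: test1_derive1. Qed.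

(** The derivatives of a test function are test functions, so both hypotheses evaluate the same
    integral of [F]; cancelling the common sign leaves the claim. This relates derivatives that were
    chosen independently of each other. *)
Lemma weak_tensor_sub (a b c d : R) i j k l F G H :
  weak_tensor a b c d i j F G -> weak_tensor a b c d (i + k) (j + l) F H ->
  weak_tensor a b c d k l G H.
Proof.
move=> FG FH phi psi tphi tpsi.
have := FG _ _ (test1_iter_derive1 k tphi) (test1_iter_derive1 l tpsi).
rewrite -!iterD FH// addnACA exprD -mulrA.
by move=> /(can_inj (signrMK _)) <-.
Qed.

Lemma weak_tensor_swap (a b c d : R) i j F G :
  mu2.-integrable setT (EFin \o F) -> mu2.-integrable setT (EFin \o G) ->
  weak_tensor a b c d i j F G ->
  weak_tensor c d a b j i (F \o swap) (G \o swap).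
Proof.
move=> Fi Gi FG psi phi tpsi tphi.
have S H k l : mu2.-integrable setT (EFin \o H) -> test1 a b k -> test1 c d l ->
    \int[mu2]_z ((H \o swap) z * tensor l k z) = \int[mu2]_z (H z * tensor k l z).
  move=> Hi tk tl.
  have [M kM] := test1_bounded tk; have [N lN] := test1_bounded tl.
  rewrite -(Rintegral_swap (integrableM_tensor Hi (smooth_measurable tk.1) kM
    (smooth_measurable tl.1) lN)).
  by apply: eq_Rintegral => z _; rewrite /tensor/= [X in _ * X]mulrC.
rewrite !S//; [|exact: test1_iter_derive1|exact: test1_iter_derive1].
by rewrite FG// addnC.
Qed.

(** The primitive of [W] over [[a, x]] times [[c, y]], kept as a double integral because this form
    is symmetric in the two variables. *)
Definition box (a c : R) W (z : R * R) : R :=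
  \int[mu2]_w (W w * tensor (fun t => step a t * step t z.1)
                            (fun t => step c t * step t z.2) w).

Lemma measurable_stepM (a x : R) :
  measurable_fun [set: mR] (fun t => step a t * step t x).
Proof. by apply: measurable_funM; apply: measurable_step. Qed.

Lemma norm_kernel_le1 (a x : R) t : `|step a t * step t x| <= 1.
Proof. exact: norm_stepM_le1. Qed.

Lemma boxE (a c : R) W z : mu2.-integrable setT (EFin \o W) ->
  box a c W z = prim a (fun t => prim c (fun s => W (t, s)) z.2) z.1.
Proof.
move=> Wi; rewrite prim_kernel /box (Rfubini_tensor Wi (measurable_stepM _ _)
  (norm_kernel_le1 _ _) (measurable_stepM _ _) (norm_kernel_le1 _ _)).
by apply: eq_Rintegral => t _; rewrite prim_kernel.
Qed.

Lemma box_swap (a c : R) W z : mu2.-integrable setT (EFin \o W) ->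
  box c a (W \o swap) (swap z) = box a c W z.
Proof.
move=> Wi; rewrite /box.
rewrite -(Rintegral_swap (integrableM_tensor Wi (measurable_stepM _ _)
  (norm_kernel_le1 _ _) (measurable_stepM _ _) (norm_kernel_le1 _ _))).
by apply: eq_Rintegral => w _; rewrite /tensor/= [X in _ * X]mulrC.
Qed.

Lemma eq_prim_ae (a b : R) f g x : x \in `[a, b] ->
  measurable_fun [set: mR] f -> measurable_fun [set: mR] g ->
  (\forall t \ae mu, t \in `[a, b] -> f t = g t) -> prim a f x = prim a g x.
Proof.
rewrite in_itv/= => /andP[ax xb] mf mg fg; rewrite !prim_kernel.
apply: ae_eq_Rintegral; try by apply: measurable_funM => //; exact: measurable_stepM.
apply: aeS fg => t fgt; rewrite /step.
have [at_|] := boolP (a <= t); last by rewrite mul0r !mulr0.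
have [tx|] := boolP (t <= x); last by rewrite !mulr0.
by rewrite fgt// in_itv/= at_ (le_trans tx).
Qed.

Lemma primD (a x : R) f g :
  mu.-integrable setT (EFin \o f) -> mu.-integrable setT (EFin \o g) ->
  prim a (fun t => f t + g t) x = prim a f x + prim a g x.
Proof.
by move=> fi gi; rewrite /prim RintegralD//; [exact: integrableS fi|exact: integrableS gi].
Qed.

(** [F] is recovered from [Fx] in [x], [Fx] from [W] in [y] by swapping, and the second formula is
    substituted into the first. *)
Lemma mixed_primitive_half (a b c d : R) F Fx W : a < b -> c < d ->
  mu2.-integrable setT (EFin \o F) -> mu2.-integrable setT (EFin \o Fx) ->
  mu2.-integrable setT (EFin \o W) ->
  weak_tensor a b c d 1 0 F Fx -> weak_tensor a b c d 0 1 Fx W ->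
  exists r p, [/\ mu.-integrable setT (EFin \o p),
    \forall z \ae mu2, rect a b c d z ->
      Fx z = p z.1 + prim c (fun t => W (z.1, t)) z.2 &
    \forall z \ae mu2, rect a b c d z ->
      F z = r z.2 + prim a p z.1 + box a c W z].
Proof.
move=> ab cd Fi Fxi Wi wF wFx.
have [r ri Fr] : exists2 r, mu.-integrable setT (EFin \o r) &
    \forall z \ae mu2, rect a b c d z -> F z = r z.2 + prim a (fun t => Fx (t, z.2)) z.1.
  apply: weak_deriv_x_primitive => // phi psi tphi tpsi.
  by have := wF phi psi tphi tpsi; rewrite /= expr1 mulN1r.
have [p pi_ Fp] : exists2 p, mu.-integrable setT (EFin \o p) &
    \forall z \ae mu2, rect a b c d z -> Fx z = p z.1 + prim c (fun t => W (z.1, t)) z.2.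
  have wFxs := weak_tensor_swap Fxi Wi wFx.
  have [|p pi_ Fp] := @weak_deriv_x_primitive R c d a b _ _ cd (integrable_swap Fxi) (integrable_swap Wi).
    move=> phi psi tphi tpsi.
    by have := wFxs phi psi tphi tpsi; rewrite /= expr1 mulN1r.
  exists p => //; move/ae_swap: Fp; apply: aeS => -[x y] /= + [xab ycd].
  exact.
exists r, p; split=> //.
have pWi := integrable_prim_x c d (integrable_swap Wi).
(* Integrable over the plane thanks to the cut, hence on almost every horizontal line; for [y] in
   [[c, d]] the cut is invisible. *)
pose Z z := step c z.2 * step z.2 d * prim c (fun t => W (z.1, t)) z.2.
have Zi : mu2.-integrable setT (EFin \o Z) by exact: (integrable_swap pWi).
(* The formula for [Fx] is needed under an integral in [x], so it is read along almost every
   horizontal line. *)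
have A : \forall y \ae mu, \forall t \ae mu, rect a b c d (t, y) ->
   Fx (t, y) = p t + prim c (fun s => W (t, s)) y.
  by have := ae_xy (ae_swap Fp).
have := aeI Fr (ae_snd (aeI A (aeI (ae_integrable_y Fxi) (ae_integrable_y Zi)))).
apply: aeS => -[x y] /= [Fxy [Ay [Fxy_i Zyi]]] [/= xab ycd].
rewrite Fxy// -addrA boxE//=; congr (_ + _).
have [cy yd] : c <= y /\ y <= d by move: ycd; rewrite /= in_itv/= => /andP.
have Zy t : Z (t, y) = prim c (fun s => W (t, s)) y by rewrite /Z/= /step cy yd !mul1r.
have Zyi' : mu.-integrable setT (EFin \o (fun t => prim c (fun s => W (t, s)) y)).
  by apply: eq_integrable Zyi => // t _; rewrite /= Zy.
rewrite -primD//; apply: (@eq_prim_ae a b) => //.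
- exact: integrableT_measurable Fxy_i.
- by apply: measurable_funD; [exact: integrableT_measurable pi_|exact: integrableT_measurable Zyi'].
- by apply: aeS Ay => t At tab; exact: At.
Qed.

End mixed_primitive.

(** * Continuity of primitives, and uniqueness of corner values and traces *)

Section continuous_representative.
Context {R : realType}.
Local Notation mu := (@lebesgue_measure R).
Local Notation mu2 := (mu \x mu)%E.
Local Notation mR := (measurableTypeR R).
Local Notation swap := (@unstable.swap R R).
Implicit Types (f g p q : R -> R) (F G W : R * R -> R).

Lemma ae_exists_itvoo (a b : R) (P : R -> Prop) : a < b ->
  (\forall x \ae mu, P x) -> exists2 x, x \in `]a, b[ & P x.
Proof.
move=> ab [N [mN N0 sN]]; apply: contrapT => H.
have : (mu `]a, b[%classic <= mu N)%E.
  apply: le_measure; rewrite ?inE//.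
  by move=> x /= xab; apply: sN => /= Px; apply: H; exists x.
by rewrite lebesgue_measure_itv/= lte_fin ab N0 -EFinD lee_fin subr_le0 leNgt ab.
Qed.

(** The two half formulas, one per variable, share the term [box]. Cancelling it leaves on each side
    a function of [x] plus a function of [y]; freezing a good [x0] shows that [r] is [prim c q] up
    to the constant [s x0 - prim a p x0]. *)
Lemma mixed_primitive (a b c d : R) F Fx Fy W : a < b -> c < d ->
  mu2.-integrable setT (EFin \o F) -> mu2.-integrable setT (EFin \o Fx) ->
  mu2.-integrable setT (EFin \o Fy) -> mu2.-integrable setT (EFin \o W) ->
  weak_tensor a b c d 1 0 F Fx -> weak_tensor a b c d 0 1 F Fy ->
  weak_tensor a b c d 0 1 Fx W -> weak_tensor a b c d 1 0 Fy W ->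
  exists C p q, [/\ mu.-integrable setT (EFin \o p),
    mu.-integrable setT (EFin \o q),
    \forall z \ae mu2, rect a b c d z ->
      Fx z = p z.1 + prim c (fun t => W (z.1, t)) z.2,
    \forall z \ae mu2, rect a b c d z ->
      Fy z = q z.2 + prim a (fun t => W (t, z.2)) z.1 &
    \forall z \ae mu2, rect a b c d z ->
      F z = C + prim a p z.1 + prim c q z.2 + box a c W z].
Proof.
move=> ab cd Fi Fxi Fyi Wi wFx wFy wFxW wFyW.
have [r [p [pi_ Fxp Fp]]] := mixed_primitive_half ab cd Fi Fxi Wi wFx wFxW.
have [s [q [qi /ae_swap Fyq /ae_swap Fq]]] := mixed_primitive_half cd ab
  (integrable_swap Fi) (integrable_swap Fyi) (integrable_swap Wi)
  (weak_tensor_swap Fi Fyi wFy) (weak_tensor_swap Fyi Wi wFyW).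
have rs : \forall z \ae mu2, rect a b c d z ->
    r z.2 + prim a p z.1 = s z.1 + prim c q z.2.
  have := aeI Fp Fq; apply: aeS => -[x y] [/= Fpz Fqz] [/= xab ycd].
  apply: (addIr (box a c W (x, y))); rewrite -Fpz//.
  by rewrite -(box_swap a c (x, y) Wi); exact: Fqz.
have [x0 x0ab rsx0] := ae_exists_itvoo ab (ae_xy rs).
exists (s x0 - prim a p x0), p, q; split=> //.
  by apply: aeS Fyq => -[x y] /= + [xab ycd]; exact.
have := aeI Fp (ae_snd rsx0); apply: aeS => -[x y] [/= Fpz rsy] [/= xab ycd].
rewrite Fpz//; congr (_ + _); rewrite addrAC; congr (_ + _).
apply: (addIr (prim a p x0)); rewrite rsy; first by ring.
by split=> //=; exact: subset_itv_oo_cc.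
Qed.

Lemma continuous_prim (a : R) p : mu.-integrable setT (EFin \o p) ->
  continuous (prim a p).
Proof.
move=> pi_ x.
(* Starting the primitive strictly to the left of both [a] and [x], with the integrand set to 0
   before [a], makes every [x] an interior point of the interval of integration. *)
pose a' := Num.min a x - 1; pose b' := Num.max a x + 1.
have a'x : a' < x by rewrite ltrBlDr ltr_pwDr// ge_min lexx orbT.
have xb' : x < b' by rewrite ltr_pwDr// le_max lexx orbT.
have a'a : a' < a by rewrite ltrBlDr ltr_pwDr// ge_min lexx.
pose q t := p t * step a t.
have qi : mu.-integrable setT (EFin \o q).
  apply: integrable_kernel => // [|t]; first exact: measurable_step.
  by have /andP[? ?] := step_ge0_le1 a t; rewrite ger0_norm.
have pq : prim a p = prim a' q.
  apply/funext => y; rewrite !prim_kernel; apply: eq_Rintegral => t _.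
  rewrite /q /step; have [at_|] := leP a t; last by rewrite !(mulr0, mul0r).
  by rewrite (le_trans (ltW a'a) at_) !mulr1 !mul1r.
have := @parameterized_integral_continuous R a' b' q (ltW (lt_trans a'x xb')) (integrableS _ _ _ qi).
move=> /(_ measurableT (measurable_itv _) (@subsetT _ _)).
move/(continuous_within_itvP _ (lt_trans a'x xb')) => [+ _ _].
by rewrite pq; apply; rewrite in_itv/= a'x.
Qed.

Lemma le_Rintegral_ae d (T : measurableType d) (nu : {measure set T -> \bar R})
    (f g : T -> R) : (forall x, 0 <= f x) -> (forall x, 0 <= g x) ->
  nu.-integrable setT (EFin \o f) -> nu.-integrable setT (EFin \o g) ->
  (\forall x \ae nu, f x <= g x) -> \int[nu]_x f x <= \int[nu]_x g x.
Proof.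
move=> f0 g0 fi gi fg; apply: fine_le; try exact: integrable_fin_num.
apply: ae_ge0_le_integral => //.
- by move=> x _; rewrite lee_fin.
- exact: measurable_int fi.
- by move=> x _; rewrite lee_fin.
- exact: measurable_int gi.
- by apply: aeS fg => x fgx _; rewrite lee_fin.
Qed.

(** For [continuous_box]: the bound depends on [g] only, so one modulus of continuity serves a whole
    family of functions [f] dominated by [g]. *)
Lemma norm_primB_le (a x y : R) f g :
  mu.-integrable setT (EFin \o f) -> mu.-integrable setT (EFin \o g) ->
  (\forall t \ae mu, `|f t| <= g t) -> (forall t, 0 <= g t) ->
  `|prim a f x - prim a f y| <= `|prim a g x - prim a g y|.
Proof.
move=> fi gi fg g0; wlog yx : x y / y <= x.
  move=> H; have [/H//|/ltW/H] := leP y x.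
  by rewrite distrC [leRHS]distrC.
(* The indicator of the part of []y, x]] that lies at or beyond [a]. *)
pose k t := step a t * step t x - step a t * step t y.
have k01 t : 0 <= k t <= 1.
  rewrite /k /step; case: (a <= t); rewrite /= ?mul0r ?subrr ?lexx ?ler01// !mul1r.
  have [ty|] /= := leP t y; first by rewrite (le_trans ty yx)/= subrr lexx ler01.
  by case: (t <= x); rewrite /= subr0 ?lexx ?ler01.
have mk : measurable_fun [set: mR] k.
  by apply: measurable_funB; exact: measurable_stepM.
have E h : mu.-integrable setT (EFin \o h) ->
    prim a h x - prim a h y = \int[mu]_t (h t * k t).
  move=> hi; rewrite !prim_kernel -RintegralB//; try exact: integrable_prim_kernel.
  by apply: eq_Rintegral => t _; rewrite -mulrBr.
have ki h : mu.-integrable setT (EFin \o h) ->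
    mu.-integrable setT (EFin \o (fun t => h t * k t)).
  move=> hi; apply: integrable_kernel => // t.
  by have /andP[? ?] := k01 t; rewrite ger0_norm.
rewrite !E// [leRHS]ger0_norm; last first.
  apply: Rintegral_ge0 => t _; rewrite mulr_ge0//.
  by have /andP[] := k01 t.
apply: (le_trans (le_normr_Rintegral _ _)) => //; first exact: ki.
apply: le_Rintegral_ae => //.
- by move=> t; rewrite mulr_ge0//; have /andP[] := k01 t.
- exact: integrable_norm (ki _ fi).
- exact: ki.
- apply: aeS fg => t fgt; have /andP[k0 _] := k01 t.
  by rewrite normrM (ger0_norm k0) ler_wpM2r.
Qed.

Lemma integrable_prim_section (c y : R) W : mu2.-integrable setT (EFin \o W) ->
  mu.-integrable setT (EFin \o (fun t => prim c (fun s => W (t, s)) y)).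
Proof.
move=> Wi.
have := integrable_Rintegral_x (integrableM_snd Wi (measurable_stepM c y) (norm_kernel_le1 c y)).
by apply: eq_integrable => // t _; rewrite /= prim_kernel.
Qed.

Lemma continuous_fst_comp f : continuous f -> continuous (fun z : R * R => f z.1).
Proof.
by move=> cf z; apply: (@continuous_comp _ _ _ fst f); [exact: cvg_fst|exact: cf].
Qed.

Lemma continuous_snd_comp f : continuous f -> continuous (fun z : R * R => f z.2).
Proof.
by move=> cf z; apply: (@continuous_comp _ _ _ snd f); [exact: cvg_snd|exact: cf].
Qed.

(** Continuity in [x] is uniform in [y]: increments are bounded by those of the primitive of [g t],
    the integral of [|W (t, s)|] over [s]. Continuity in [y] along the single line [x = x0] then
    suffices. *)
Lemma continuous_box (a c : R) W : mu2.-integrable setT (EFin \o W) ->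
  continuous (box a c W).
Proof.
move=> Wi [x0 y0].
have Ni : mu2.-integrable setT (EFin \o (fun z => `|W z|)) by exact: integrable_norm Wi.
have gi := integrable_Rintegral_x Ni; set g := fun t => \int[mu]_s _ in gi.
have bx x y : `|box a c W (x, y) - box a c W (x0, y)| <= `|prim a g x - prim a g x0|.
  rewrite !boxE//; apply: norm_primB_le => //.
  - exact: integrable_prim_section.
  - by apply: aeS (ae_integrable_x Wi) => t Wt; exact: norm_prim_le.
  - by move=> t; apply: Rintegral_ge0.
have cy : continuous (fun y => box a c W (x0, y)).
  rewrite (_ : (fun y => _) = prim c (fun s => prim a (fun t => (W \o swap) (s, t)) x0)).
    by apply: continuous_prim; apply: integrable_prim_section; exact: integrable_swap.
  apply/funext => y; rewrite -(box_swap a c (x0, y) Wi) boxE//.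
  exact: integrable_swap.
have cx := @continuous_prim a g gi.
apply/cvgrPdist_lt => e e0; have e20 : 0 < e / 2 by rewrite divr_gt0.
have Hx : \forall z \near (x0, y0), `|prim a g x0 - prim a g z.1| < e / 2.
  by have /cvgrPdist_lt := @continuous_fst_comp _ cx (x0, y0); apply.
have Hy : \forall z \near (x0, y0), `|box a c W (x0, y0) - box a c W (x0, z.2)| < e / 2.
  by have /cvgrPdist_lt := @continuous_snd_comp _ cy (x0, y0); apply.
near=> z.
rewrite (_ : _ - _ = (box a c W (x0, y0) - box a c W (x0, z.2)) -
  (box a c W z - box a c W (x0, z.2))); last by ring.
rewrite (le_lt_trans (ler_normB _ _))// [ltRHS]splitr ltrD//; first by near: z.
have zx : `|prim a g x0 - prim a g z.1| < e / 2 by near: z.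
by apply: le_lt_trans zx; rewrite distrC [leRHS]distrC distrC; case: (z).
Unshelve. all: by end_near. Qed.

(** If the values at [c] differed, so would those on a right neighbourhood of [c]; but that contains
    an interval of positive length, hence a point of agreement. *)
Lemma continuous_ae_eq_left (c d : R) f g : c < d ->
  {within `[c, d], continuous f} -> {within `[c, d], continuous g} ->
  (\forall y \ae mu, y \in `[c, d] -> f y = g y) -> f c = g c.
Proof.
move=> cd /(continuous_within_itvP _ cd)[_ fc _] /(continuous_within_itvP _ cd)[_ gc _] fg.
apply/eqP; rewrite -subr_eq0; apply/negPn/negP => fgc.
have fgcv : (f y - g y) @[y --> c^'+] --> f c - g c by exact: cvgB.
move/cvgrPdist_lt : fgcv.
move=> /(_ `|f c - g c|); rewrite normr_gt0 fgc => /(_ isT); rewrite /= near_withinE => -[e /= e0 eP].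
have [|y] := @ae_exists_itvoo c (Num.min d (c + e)) _ _ fg.
  by rewrite lt_min cd ltrDl.
rewrite in_itv/= lt_min => /andP[cy /andP[yd ye]] fgy.
have /eP /(_ cy) : ball_ Num.norm c e y.
  by rewrite /ball_/= ltr0_norm ?subr_lt0// opprB ltrBlDl.
by rewrite fgy ?subrr ?subr0 ?ltxx// in_itv/= (ltW cy) (ltW yd).
Qed.

Lemma continuous_ae_eq_corner (a b c d : R) F G : a < b -> c < d ->
  {within rect a b c d, continuous F} -> {within rect a b c d, continuous G} ->
  (\forall z \ae mu2, rect a b c d z -> F z = G z) -> F (a, c) = G (a, c).
Proof.
move=> ab cd Fc Gc FG.
have ac : (a, c) \in rect a b c d.
  by rewrite inE; split; rewrite /= in_itv/= lexx ltW.
have W H : {within rect a b c d, continuous H} ->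
    H z @[z --> within (rect a b c d) (nbhs (a, c))] --> H (a, c).
  by move=> /(_ (a, c)); rewrite {1}/continuous_at nbhs_subspace_in//; exact: set_mem.
apply/eqP; rewrite -subr_eq0; apply/negPn/negP => fgc.
have FGcv : (F z - G z) @[z --> within (rect a b c d) (nbhs (a, c))] --> F (a, c) - G (a, c).
  by apply: cvgB; exact: W.
move/cvgrPdist_lt : FGcv.
move=> /(_ `|F (a, c) - G (a, c)|); rewrite normr_gt0 fgc => /(_ isT); rewrite near_withinE => -[[A B]] /= [[e e0 eA] [e' e'0 eB]] AB.
have [|x xI] := @ae_exists_itvoo a (Num.min b (a + e)) _ _ (ae_xy FG).
  by rewrite lt_min ab ltrDl.
move=> /(@ae_exists_itvoo c (Num.min d (c + e')))[|y yI FGxy].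
  by rewrite lt_min cd ltrDl.
move: xI yI; rewrite !in_itv/= !lt_min => /andP[ax /andP[xb xe]] /andP[cy /andP[yd ye]].
have xyr : rect a b c d (x, y).
  by split; rewrite /= in_itv/= ?(ltW ax) ?(ltW cy) ltW.
have : (A `*` B) (x, y).
  split; [apply: eA|apply: eB];
    by rewrite /ball_/= ltr0_norm ?subr_lt0// opprB ltrBlDl.
move=> /AB /= /(_ xyr); rewrite FGxy//.
by rewrite subrr subr0 ltxx.
Qed.

(** Whatever [xget] selects comes from some continuous representative, which agrees with [H] at the
    corner; the default 0 is excluded because [H] provides a candidate. *)
Lemma corner_value_eq (a b c d : R) F (H : R * R -> R) : a < b -> c < d ->
  {within rect a b c d, continuous H} ->
  (\forall z \ae mu2, rect a b c d z -> H z = F z) ->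
  corner_value a b c d F = H (a, c).
Proof.
move=> ab cd Hc HF; rewrite /corner_value; case: xgetP => [p _ [G [GF Gc <-]]|].
  apply: (continuous_ae_eq_corner ab cd Gc Hc).
  have := aeI HF GF; apply: aeS => z [hz gz] rz.
  by rewrite hz// gz.
by move=> /(_ (H (a, c))) []; exists H; split.
Qed.

(** On almost every vertical line both representatives are continuous and agree almost everywhere,
    hence agree at [c]. The function [g0] supplies the candidate that excludes the default. *)
Lemma trace_y_eq (a b c d : R) F (H : R * R -> R) g g0 : c < d -> L2itv a b g0 ->
  (forall x, x \in `[a, b] -> g0 x = g x) ->
  (\forall z \ae mu2, rect a b c d z -> H z = F z) ->
  (\forall x \ae mu, x \in `[a, b] ->
     {within `[c, d], continuous (fun y => H (x, y))} /\ H (x, c) = g x) ->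
  L2itv a b (trace_y a b c d F) /\
  \forall x \ae mu, x \in `[a, b] -> trace_y a b c d F x = g x.
Proof.
move=> cd g0L g0g HF Hg; rewrite /trace_y; case: xgetP => [k _ [kL [G [GF Gk]]]|].
  split=> //; have := aeI (ae_xy (aeI HF GF)) (aeI Hg Gk).
  apply: aeS => x [HG [Hx Gx]] xab.
  have [Hxc <-] := Hx xab; have [Gxc <-] := Gx xab.
  apply: (continuous_ae_eq_left cd Gxc Hxc).
  by apply: aeS HG => y [Hy Gy] ycd; rewrite Gy// Hy.
move=> /(_ g0) []; split=> //; exists H; split=> //.
by apply: aeS Hg => x Hx xab; have [? ->] := Hx xab; rewrite g0g.
Qed.

End continuous_representative.

(** * Square integrability, and the traces as members of L_2 *)

Section square_integrable.
Context {R : realType}.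
Local Notation mu := (@lebesgue_measure R).
Local Notation mu2 := (mu \x mu)%E.
Local Notation mR := (measurableTypeR R).
Local Notation swap := (@unstable.swap R R).
Implicit Types (f g p q : R -> R) (F G W : R * R -> R).

Lemma integrable_sqr_Lfun2 d (T : measurableType d) (nu : {measure set T -> \bar R})
    (f : T -> R) : measurable_fun setT f ->
  nu.-integrable setT (EFin \o (fun x => f x ^+ 2)) -> f \in Lfun nu 2%:E.
Proof.
move=> mf /integrableP[_ fi]; rewrite inE; apply/andP; split; first by rewrite inE.
rewrite inE /= /finite_norm unlock; apply: poweR_lty.
apply: le_lt_trans fi; rewrite le_eqVlt; apply/orP; left; apply/eqP.
apply: eq_integral => x _.
by rewrite /= powR_mulrn// normrX.
Qed.

Lemma Lfun2_measurable d (T : measurableType d) (nu : {measure set T -> \bar R})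
    (f : T -> R) : f \in Lfun nu 2%:E -> measurable_fun setT f.
Proof. by rewrite inE => /andP[+ _]; rewrite inE. Qed.

Lemma L2rect_integrable_sqr (a b c d : R) F : L2rect a b c d F ->
  mu2.-integrable setT (EFin \o (fun z => (F \_ (rect a b c d)) z ^+ 2)).
Proof. by move=> /Lfun2_integrable_sqr. Qed.

Lemma L2rect_integrable (a b c d : R) F : L2rect a b c d F ->
  mu2.-integrable setT (EFin \o (F \_ (rect a b c d))).
Proof.
move=> FL; have mF := Lfun2_measurable FL.
have Ti := integrable_tensor (integrable_indic_itvcc a b) (integrable_indic_itvcc c d).
pose F0 := F \_ (rect a b c d); rewrite -/F0 in mF *.
apply: (@integrable_le R _ _ mu2 F0 (fun z => F0 z ^+ 2 +
  tensor (fun x => step a x * step x b) (fun y => step c y * step y d) z)).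
- exact: mF.
- move=> [x y]; rewrite /F0 patchE; case: ifPn => [|_].
    rewrite inE => -[/=]; rewrite !in_itv/= => /andP[ax xb] /andP[cy yd].
    rewrite /tensor/= /step ax xb cy yd !mulr1.
    (* Gives [|F| <= F ^+ 2 + 1 / 4], hence the bound by [F ^+ 2 + 1] on the rectangle. *)
    have := sqr_ge0 (`|F (x, y)| - 2^-1); rewrite sqrrB -normrX ger0_norm ?sqr_ge0//.
    by move: (F _ ^+ 2) `|F _| => u v; rewrite mulr1n; lra.
  by rewrite (_ : point = 0 :> R)// normr0 expr0n/= add0r /tensor mulr_ge0// mulr_ge0//;
    case/andP: (step_ge0_le1 _ _).
have := integrableD measurableT (L2rect_integrable_sqr FL) Ti.
by apply: eq_integrable => // z _.
Qed.

Lemma Rintegral_patchM d (T : measurableType d) (nu : {measure set T -> \bar R})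
    (D : set T) (f g : T -> R) :
  \int[nu]_(x in D) (f x * g x) = \int[nu]_x ((f \_ D) x * g x).
Proof.
rewrite Rintegral_mkcond; apply: eq_Rintegral => x _.
by rewrite !patchE; case: ifP; rewrite ?mul0r.
Qed.

Lemma iter_pdx_tensor i f g : smooth f ->
  iter i pdx (tensor f g) = tensor (iter i (@derive1 R R) f) g.
Proof.
move=> sf; elim: i => //= i ->; rewrite pdx_tensor//.
by elim: i => //= i; exact: smooth_derive1.
Qed.

Lemma iter_pdy_tensor i f g : smooth g ->
  iter i pdy (tensor f g) = tensor f (iter i (@derive1 R R) g).
Proof.
move=> sg; elim: i => //= i ->; rewrite pdy_tensor//.
by elim: i => //= i; exact: smooth_derive1.
Qed.

Lemma is_weak_deriv_tensor (a b c d : R) i j F G : is_weak_deriv a b c d i j F G ->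
  weak_tensor a b c d i j (F \_ (rect a b c d)) (G \_ (rect a b c d)).
Proof.
move=> FG phi psi tphi tpsi; have := FG _ (test_function_tensor tphi tpsi).
by rewrite (iter_pdy_tensor j _ tpsi.1) (iter_pdx_tensor i _ tphi.1)
  (Rintegral_patchM mu2 _ F) (Rintegral_patchM mu2 _ G).
Qed.

Lemma prim_cst (c y k : R) : c <= y -> prim c (fun=> k) y = k * (y - c).
Proof.
move=> cy; rewrite /prim Rintegral_cst//; congr (_ * _).
have E : mu `[c, y]%classic = (y - c)%:E.
  rewrite lebesgue_measure_itv/= lte_fin; case: ltgtP cy => // ->.
  by rewrite subrr.
by rewrite [LHS](congr1 fine E).
Qed.

(** Cauchy-Schwarz on [[c, y]], with the length [d - c] in place of [y - c]: it is uniform in [y],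
    and it is positive, so the proof may divide by it. *)
Lemma sqr_prim_le (c d y : R) f : c < d -> y \in `[c, d] ->
  mu.-integrable setT (EFin \o f) ->
  mu.-integrable setT (EFin \o (fun t => f t ^+ 2)) ->
  prim c f y ^+ 2 <= (d - c) * \int[mu]_t (f t ^+ 2).
Proof.
move=> cd; rewrite in_itv/= => /andP[cy yd] fi f2i.
set m := prim c f y; have L0 : 0 < d - c by rewrite subr_gt0.
pose k t := step c t * step t y.
have k2 t : k t ^+ 2 = k t.
  by rewrite /k /step; case: (c <= t); case: (t <= y); rewrite /= ?(mulr0, mul0r, mulr1, expr0n, expr1n).
have ki := integrable_indic_itvcc c y.
have f2ki := integrable_prim_kernel c y f2i.
have fki := integrable_prim_kernel c y fi.
have kE : \int[mu]_t k t = y - c.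
  transitivity (prim c (fun=> 1) y).
    by rewrite prim_kernel; apply: eq_Rintegral => t _; rewrite mul1r.
  by rewrite prim_cst// mul1r.
(* AM-GM: [2 (m / L) f <= f^2 + (m / L)^2], integrated over [c, y] *)
have : \int[mu]_t (2 * (m / (d - c)) * (f t * k t)) <=
    \int[mu]_t (f t ^+ 2 * k t + (m / (d - c)) ^+ 2 * k t).
  apply: le_Rintegral => //.
  - have := integrableZl measurableT (2 * (m / (d - c))) fki.
    by apply: eq_integrable => // t _; rewrite /= EFinM.
  - have := integrableD measurableT f2ki (integrableZl measurableT ((m / (d - c)) ^+ 2) ki).
    by apply: eq_integrable => // t _; rewrite /= EFinM.
  move=> t _; have k0 : 0 <= k t by rewrite -k2 sqr_ge0.
  have := mulr_ge0 (sqr_ge0 (f t - m / (d - c))) k0.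
  by rewrite sqrrB; lra.
rewrite RintegralZl// RintegralD//; last first.
  have := integrableZl measurableT ((m / (d - c)) ^+ 2) ki.
  by apply: eq_integrable => // t _; rewrite /= EFinM.
rewrite RintegralZl// kE -prim_kernel -/m => H.
have H2 : \int[mu]_t (f t ^+ 2 * k t) <= \int[mu]_t (f t ^+ 2).
  apply: le_Rintegral => // t _; rewrite ler_piMr ?sqr_ge0//.
  by have := norm_kernel_le1 c y t; rewrite ger0_norm// -[_ * _]/(k t) -k2 sqr_ge0.
have H3 : (m / (d - c)) ^+ 2 * (y - c) <= m ^+ 2 / (d - c).
  rewrite exprMn exprVn -mulrA ler_wpM2l ?sqr_ge0// expr2 invfM -mulrA ler_piMr ?invr_ge0 ?(ltW L0)//.
  by rewrite ler_pdivrMl// mulr1 lerD2r.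
rewrite mulrC -ler_pdivrMr//.
rewrite (_ : 2 * (m / (d - c)) * m = 2 * (m ^+ 2 / (d - c))) in H; last by ring.
by have := le_trans H (lerD H2 H3); rewrite mulr_natl mulr2n lerD2r.
Qed.

Lemma prim_id (a : R) f : prim a f a = 0.
Proof. by rewrite /prim set_itv1 Rintegral_set1. Qed.

Lemma box_id_y (a c x : R) W : mu2.-integrable setT (EFin \o W) ->
  box a c W (x, c) = 0.
Proof. by move=> Wi; rewrite boxE// /prim Rintegral_eq0// => t _; exact: prim_id. Qed.

Lemma prim_patch (a b x : R) f : x \in `[a, b] -> prim a (f \_ `[a, b]) x = prim a f x.
Proof.
rewrite in_itv/= => /andP[_ xb]; apply: eq_Rintegral => t.
rewrite inE/= in_itv/= patchE => /andP[at_ tx]; rewrite mem_set//= in_itv/= at_.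
exact: le_trans xb.
Qed.

(** On some line [y = y0] the function [F] is square integrable and the formula holds for almost
    every [x]; there [p] is [F] minus a primitive of [W], and the latter is square integrable in [x]
    by [sqr_prim_le]. *)
Lemma L2itv_trace (a b c d : R) F W p : c < d ->
  mu2.-integrable setT (EFin \o (fun z => F z ^+ 2)) ->
  mu2.-integrable setT (EFin \o W) ->
  mu2.-integrable setT (EFin \o (fun z => W z ^+ 2)) ->
  mu.-integrable setT (EFin \o p) ->
  (\forall z \ae mu2, rect a b c d z ->
    F z = p z.1 + prim c (fun t => W (z.1, t)) z.2) ->
  L2itv a b p.
Proof.
move=> cd F2i Wi W2i pi_ Fp.
have [y0 y0cd [F2y Fpy]] := ae_exists_itvoo cd
  (aeI (ae_integrable_y F2i) (ae_xy (ae_swap Fp))).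
have y0cd' : y0 \in `[c, d] by exact: subset_itv_oo_cc.
have mp : measurable_fun [set: mR] (p \_ `[a, b]).
  by apply/(measurable_restrictT _ _).1 => //; apply: measurable_funTS; exact: integrableT_measurable pi_.
apply: integrable_sqr_Lfun2 => //.
(* From [(u - v) ^+ 2 <= 2 * u ^+ 2 + 2 * v ^+ 2], with [v] the primitive of [W] at [y0]. *)
pose h x := 2 * F (x, y0) ^+ 2 + 2 * (d - c) * \int[mu]_s (W (x, s) ^+ 2).
apply: (@integrable_le_ae _ _ _ mu _ h).
- exact: measurable_funX.
- have := aeI Fpy (aeI (ae_integrable_x Wi) (ae_integrable_x W2i)).
  apply: aeS => x [Fpx [Wx W2x]].
  have W0 : 0 <= \int[mu]_s (W (x, s) ^+ 2) by apply: Rintegral_ge0 => s _; exact: sqr_ge0.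
  have dc0 : 0 <= d - c by rewrite subr_ge0 ltW.
  rewrite ger0_norm ?sqr_ge0// patchE; case: ifPn => [|_]; last first.
    rewrite (_ : point = 0 :> R)// expr0n/=; apply: addr_ge0.
      by apply: mulr_ge0 => //; exact: sqr_ge0.
    by apply: mulr_ge0 => //; apply: mulr_ge0.
  rewrite inE/= => xab.
  have Wle := sqr_prim_le cd y0cd' Wx W2x.
  have := Fpx (conj xab y0cd'); rewrite /= => /eqP; rewrite -subr_eq => /eqP <-.
  move: Wle; rewrite /h -mulrA.
  move: (prim _ _ _) (F _) (_ * \int[mu]_s _) => u v w uw.
  have := sqr_ge0 (v + u); rewrite sqrrD sqrrB; lra.
- have := integrableD measurableT (integrableZl measurableT 2 F2y)
    (integrableZl measurableT (2 * (d - c)) (integrable_Rintegral_x W2i)).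
  by apply: eq_integrable => // x _; rewrite /= /h EFinD !EFinM.
Qed.

Lemma L2itv_continuous (a b : R) f : continuous f -> L2itv a b f.
Proof.
move=> cf; have mf : measurable_fun [set: mR] f by exact: continuous_measurable_fun.
apply: integrable_sqr_Lfun2.
  by apply/(measurable_restrictT _ _).1 => //; exact: measurable_funTS.
have : mu.-integrable `[a, b] (EFin \o (fun x => f x ^+ 2)).
  apply: continuous_compact_integrable; first exact: segment_compact.
  apply: continuous_subspaceT => x; apply: cvgM; exact: cf.
move=> /(integrable_mkcond _ _).1 /= => /(_ (measurable_itv _)).
apply: eq_integrable => // x _; rewrite /= !patchE; case: ifP => // _.
by rewrite (_ : point = 0 :> R)// expr0n.
Qed.

Lemma L2itv_integrable (a b : R) f : L2itv a b f ->
  mu.-integrable setT (EFin \o (f \_ `[a, b])).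
Proof.
move=> fL; have mf := Lfun2_measurable fL.
have := integrableD measurableT (Lfun2_integrable_sqr fL) (integrable_indic_itvcc a b).
apply: integrable_le => // x; rewrite patchE; case: ifPn => [|_].
  rewrite inE/= in_itv/= /step => /andP[-> ->]; rewrite !mulr1.
  have := sqr_ge0 (`|f x| - 2^-1); rewrite sqrrB -normrX ger0_norm ?sqr_ge0//.
  by move: (f _ ^+ 2) `|f _| => u v; rewrite mulr1n; lra.
rewrite (_ : point = 0 :> R)// normr0 expr0n/= add0r mulr_ge0//;
  by case/andP: (step_ge0_le1 a x).
Qed.

Lemma rect_swap (a b c d : R) (z : R * R) : rect a b c d (swap z) <-> rect c d a b z.
Proof. by split=> -[]. Qed.

Lemma trace_x_swap (a b c d : R) F :
  trace_x a b c d F = trace_y c d a b (F \o swap).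
Proof.
rewrite /trace_x /trace_y; congr xget; apply/seteqP; split=> g /= [gL [h [hF hg]]];
  split=> //; exists (h \o swap); split=> //.
- by move/ae_swap : hF; apply: aeS => z hz /rect_swap; exact: hz.
- by move/ae_swap : hF; apply: aeS => -[x y] hz /rect_swap; exact: hz.
Qed.

Lemma continuous_pair_r (F : R * R -> R) (x : R) :
  continuous F -> continuous (fun y => F (x, y)).
Proof.
move=> cF y A /(cF (x, y)) [[B C]] /= [nB nC] BC.
apply: filterS nC => t Ct; apply: (BC (x, t)); split=> //=.
exact: nbhs_singleton nB.
Qed.

Lemma continuous_mixed (a c C : R) p q W :
  mu.-integrable setT (EFin \o p) -> mu.-integrable setT (EFin \o q) ->
  mu2.-integrable setT (EFin \o W) ->
  continuous (fun z => C + prim a p z.1 + prim c q z.2 + box a c W z).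
Proof.
move=> pi_ qi Wi z; apply: cvgD; last exact: continuous_box.
apply: cvgD.
  by apply: cvgD; [exact: cvg_cst|exact: (continuous_fst_comp (@continuous_prim _ a p pi_))].
exact: (continuous_snd_comp (@continuous_prim _ c q qi)).
Qed.

(** At [y = c] every [y]-primitive and the term [box] vanish. What remains is [p] for [Fx], whose
    representative is continuous in [y] for almost every [x], and [C + prim a p] for [F]. *)
Lemma mixed_trace_y (a b c d : R) (F Fx W : R * R -> R) (C : R) p q : a < b -> c < d ->
  mu2.-integrable setT (EFin \o W) -> mu2.-integrable setT (EFin \o (fun z => W z ^+ 2)) ->
  mu2.-integrable setT (EFin \o (fun z => (Fx \_ (rect a b c d)) z ^+ 2)) ->
  mu.-integrable setT (EFin \o p) -> mu.-integrable setT (EFin \o q) ->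
  (\forall z \ae mu2, rect a b c d z ->
    (Fx \_ (rect a b c d)) z = p z.1 + prim c (fun t => W (z.1, t)) z.2) ->
  (\forall z \ae mu2, rect a b c d z ->
    F z = C + prim a p z.1 + prim c q z.2 + box a c W z) ->
  [/\ L2itv a b (trace_y a b c d Fx),
      forall x, x \in `[a, b] -> prim a (trace_y a b c d Fx) x = prim a p x &
      \forall x \ae mu, x \in `[a, b] -> trace_y a b c d F x = C + prim a p x].
Proof.
move=> ab cd Wi W2i Fx2i pi_ qi FxE FE.
have pL := L2itv_trace cd Fx2i Wi W2i pi_ FxE.
have [PL Pp] : L2itv a b (trace_y a b c d Fx) /\
    \forall x \ae mu, x \in `[a, b] -> trace_y a b c d Fx x = p x.
  apply: (@trace_y_eq _ a b c d Fx (fun z => p z.1 + prim c (fun t => W (z.1, t)) z.2) p p) => //.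
    apply: aeS FxE => z Fz rz; rewrite -Fz// patchE mem_set//.
  apply: aeS (ae_integrable_x Wi) => x Wx _ /=; rewrite prim_id addr0; split=> //.
  apply: continuous_subspaceT => y; apply: cvgD; first exact: cvg_cst.
  exact: (@continuous_prim _ c _ Wx).
split=> //.
- move=> x xab; rewrite -(prim_patch _ xab) -(prim_patch p xab).
  apply: (eq_prim_ae xab); [exact: (Lfun2_measurable PL)|exact: (Lfun2_measurable pL)|].
  by apply: aeS Pp => t Pt tab; rewrite !patchE mem_set// Pt.
- have cH : continuous (fun x => C + prim a p x).
    by move=> x; apply: cvgD; [exact: cvg_cst|exact: continuous_prim].
  apply: (@trace_y_eq _ a b c d F (fun z => C + prim a p z.1 + prim c q z.2 + box a c W z) _ _ cd
    (L2itv_continuous a b cH) _ _ _).2 => //.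
    by apply: aeS FE => z Fz rz; rewrite Fz.
  apply: aeW => x _; split; last first.
    by rewrite /= prim_id box_id_y// !addr0.
  have cx := @continuous_pair_r _ x (@continuous_mixed a c C p q W pi_ qi Wi).
  by apply: continuous_subspaceT => y; exact: cx.
Qed.

End square_integrable.

(** * The first-order formula with the actual traces, and repeated primitives *)

Section representation.
Context {R : realType}.
Local Notation mu := (@lebesgue_measure R).
Local Notation mu2 := (mu \x mu)%E.
Local Notation swap := (@unstable.swap R R).
Implicit Types (f g p q : R -> R) (F W : R * R -> R).

Lemma patch_swap (a b c d : R) F :
  (F \o swap) \_ (rect c d a b) = (F \_ (rect a b c d)) \o swap.
Proof.
apply/funext => -[x y] /=; rewrite !patchE; congr (if _ then _ else _).
by apply/idP/idP; rewrite !inE => -[].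
Qed.

(** The [y] half is [mixed_trace_y] for the swapped functions. The last two conclusions, on the
    traces of [F] itself, serve at second order, where the trace of a first derivative must be
    expressed by that of the next one. *)
Lemma mixed_formula (a b c d : R) (F Fx Fy W : R * R -> R) : a < b -> c < d ->
  L2rect a b c d F -> L2rect a b c d Fx -> L2rect a b c d Fy -> L2rect a b c d W ->
  weak_tensor a b c d 1 0 (F \_ (rect a b c d)) (Fx \_ (rect a b c d)) ->
  weak_tensor a b c d 0 1 (F \_ (rect a b c d)) (Fy \_ (rect a b c d)) ->
  weak_tensor a b c d 0 1 (Fx \_ (rect a b c d)) (W \_ (rect a b c d)) ->
  weak_tensor a b c d 1 0 (Fy \_ (rect a b c d)) (W \_ (rect a b c d)) ->
  let C := corner_value a b c d F in
  let P := trace_y a b c d Fx in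
  let Q := trace_x a b c d Fy in
  [/\ L2itv a b P, L2itv c d Q,
    \forall z \ae mu2, rect a b c d z ->
      F z = C + prim a P z.1 + prim c Q z.2 + box a c (W \_ (rect a b c d)) z,
    \forall x \ae mu, x \in `[a, b] -> trace_y a b c d F x = C + prim a P x &
    \forall y \ae mu, y \in `[c, d] -> trace_x a b c d F y = C + prim c Q y].
Proof.
move=> ab cd FL FxL FyL WL wFx wFy wFxW wFyW C P Q.
have Wi := L2rect_integrable WL; have W2i := L2rect_integrable_sqr WL.
have [C0 [p [q [pi_ qi FxE FyE FE0]]]] := mixed_primitive ab cd (L2rect_integrable FL)
  (L2rect_integrable FxL) (L2rect_integrable FyL) Wi wFx wFy wFxW wFyW.
set W0 := W \_ _ in Wi W2i FxE FyE FE0 *.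
have FE : \forall z \ae mu2, rect a b c d z ->
    F z = C0 + prim a p z.1 + prim c q z.2 + box a c W0 z.
  by apply: aeS FE0 => z Fz rz; rewrite -Fz// patchE mem_set.
have CE : C = C0.
  rewrite /C (@corner_value_eq _ a b c d F
    (fun z => C0 + prim a p z.1 + prim c q z.2 + box a c W0 z))//.
  - by rewrite !prim_id box_id_y// !addr0.
  - by apply: continuous_subspaceT => z; exact: continuous_mixed.
  - by apply: aeS FE => z Fz rz; rewrite Fz.
have [PL Pp trF] := mixed_trace_y ab cd Wi W2i (L2rect_integrable_sqr FxL) pi_ qi FxE FE.
have FyE' : \forall z \ae mu2, rect c d a b z -> ((Fy \o swap) \_ (rect c d a b)) z =
    q z.1 + prim a (fun t => (W0 \o swap) (z.1, t)) z.2.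
  by rewrite patch_swap; move/ae_swap : FyE; apply: aeS => z Fz /rect_swap; exact: Fz.
have FE' : \forall z \ae mu2, rect c d a b z ->
    (F \o swap) z = C0 + prim c q z.1 + prim a p z.2 + box c a (W0 \o swap) z.
  move/ae_swap : FE; apply: aeS => -[y x] Fz /rect_swap rz.
  by rewrite /= Fz//= (addrAC C0); congr (_ + _); exact/esym/(box_swap a c (x, y) Wi).
have Fy2i : mu2.-integrable setT (EFin \o (fun z => ((Fy \o swap) \_ (rect c d a b)) z ^+ 2)).
  by rewrite patch_swap; exact: (integrable_swap (L2rect_integrable_sqr FyL)).
have [QL Qq trF'] := mixed_trace_y cd ab (integrable_swap Wi) (integrable_swap W2i) Fy2i qi pi_ FyE' FE'.
rewrite -!trace_x_swap in QL Qq trF'; split=> //.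
- apply: aeS FE => -[x y] Fz rz; have [/= xab ycd] := rz.
  by rewrite Fz//= CE Pp// Qq.
- by apply: aeS trF => x trx xab; rewrite trx// CE Pp.
- by apply: aeS trF' => y try_ ycd; rewrite try_// CE Qq.
Qed.

Lemma step_le (s t : R) : s <= t -> step s t = 1.
Proof. by rewrite /step => ->. Qed.

Lemma step_gt (s t : R) : t < s -> step s t = 0.
Proof. by rewrite /step ltNge => /negbTE ->. Qed.

(** Cauchy's formula for repeated integration: [triangle] with [f] the indicator of [[a, x]], whose
    integral from [t] onwards is [x - t]. *)
Lemma prim_prim (a x : R) g : mu.-integrable setT (EFin \o g) ->
  prim a (prim a g) x = prim a (fun t => (x - t) * g t) x.
Proof.
move=> gi; rewrite prim_kernel.
under eq_Rintegral do rewrite mulrC.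
rewrite (triangle a (integrable_indic_itvcc a x) gi) prim_kernel.
apply: eq_Rintegral => t _.
have [at_|ta] := leP a t; last by rewrite (step_gt ta) !(mulr0, mul0r).
rewrite (step_le at_) !mulr1 mul1r.
have -> : \int[mu]_u (step a u * step u x * step t u) = prim t (fun=> 1) x.
  rewrite prim_kernel; apply: eq_Rintegral => u _; rewrite mul1r.
  have [tu|ut] := leP t u; last by rewrite (step_gt ut) mulr0 mul0r.
  by rewrite (step_le (le_trans at_ tu)) (step_le tu) mulr1.
have [tx|xt] := leP t x; first by rewrite prim_cst// (step_le tx) mul1r mulr1 mulrC.
by rewrite (step_gt xt) mulr0 /prim set_itv_ge ?Rintegral_set0 ?mulr0// -leNgt.
Qed.

Lemma continuous_integrable (a x : R) f : continuous f ->
  mu.-integrable `[a, x] (EFin \o f).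
Proof.
move=> cf; apply: continuous_compact_integrable; first exact: segment_compact.
exact: continuous_subspaceT.
Qed.

Lemma prim_continuousD (a x : R) f g : continuous f -> continuous g ->
  prim a (fun t => f t + g t) x = prim a f x + prim a g x.
Proof. by move=> cf cg; rewrite /prim RintegralD//; exact: continuous_integrable. Qed.

Lemma prim_continuousZ (a x k : R) f : continuous f ->
  prim a (fun t => k * f t) x = k * prim a f x.
Proof. by move=> cf; rewrite /prim RintegralZl//; exact: continuous_integrable. Qed.

Lemma eq_prim (a x : R) f g : (forall t, a <= t <= x -> f t = g t) ->
  prim a f x = prim a g x.
Proof. by move=> fg; apply: eq_Rintegral => t; rewrite inE/= in_itv/=; exact: fg. Qed.

Lemma prim_ae_affine (a b x C : R) P p : x \in `[a, b] ->
  L2itv a b P -> L2itv a b p ->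
  (\forall t \ae mu, t \in `[a, b] -> P t = C + prim a p t) ->
  prim a P x = C * (x - a) + prim a (fun t => (x - t) * p t) x.
Proof.
move=> xab PL pL Pp; have pi_ := L2itv_integrable pL.
have cp : continuous (prim a (p \_ `[a, b])) by exact: continuous_prim.
have [ax xb] : a <= x /\ x <= b by move: xab; rewrite in_itv/= => /andP.
transitivity (prim a (fun t => C + prim a (p \_ `[a, b]) t) x).
  rewrite -(prim_patch P xab); apply: (eq_prim_ae xab).
  - exact: (Lfun2_measurable PL).
  - by apply: continuous_measurable_fun => t; apply: cvgD; [exact: cvg_cst|exact: cp].
  - by apply: aeS Pp => t Pt tab; rewrite patchE mem_set// Pt// prim_patch.
rewrite prim_continuousD//; last by move=> t; exact: cvg_cst.
rewrite prim_cst// prim_prim//; congr (_ + _); apply: eq_prim => t /andP[at_ tx].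
by rewrite patchE mem_set//= in_itv/= at_ (le_trans tx).
Qed.

End representation.

(** * Integrating the first-order formula over a rectangle *)

Section iterated_box.
Context {R : realType}.
Local Notation mu := (@lebesgue_measure R).
Local Notation mu2 := (mu \x mu)%E.
Local Notation mR := (measurableTypeR R).
Implicit Types (p q : R -> R) (V W : R * R -> R).

(** The kernel [x - t] cut to [[a, x]]; being bounded by [|x - a|], it preserves integrability over
    the whole line. *)
Definition ramp (a x t : R) : R := (x - t) * (step a t * step t x).

Lemma measurable_ramp (a x : R) : measurable_fun [set: mR] (ramp a x).
Proof.
apply: measurable_funM; last exact: measurable_stepM.
exact: measurable_funB.
Qed.

Lemma rampE (a x t : R) : a <= t <= x -> ramp a x t = x - t.
Proof. by case/andP => at_ tx; rewrite /ramp !step_le// !mulr1. Qed.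

Lemma ramp_step (a x t : R) : ramp a x t * (step a t * step t x) = ramp a x t.
Proof.
rewrite /ramp; have [at_|ta] := leP a t; last by rewrite (step_gt ta) !(mul0r, mulr0).
have [tx|xt] := leP t x; last by rewrite (step_gt xt) !(mul0r, mulr0).
by rewrite !step_le// !mulr1.
Qed.

Lemma norm_ramp_le (a x t : R) : `|ramp a x t| <= `|x - a|.
Proof.
rewrite /ramp; have [at_|ta] := leP a t; last by rewrite (step_gt ta) !(mul0r, mulr0, normr0).
have [tx|xt] := leP t x; last by rewrite (step_gt xt) !(mul0r, mulr0, normr0).
by rewrite !step_le// !mulr1 !ger0_norm ?subr_ge0// ?lerB// (le_trans at_).
Qed.

(** A repeated [y]-integration, hence the [ramp] kernel. The double integral is then read in the
    other order, so that the result is an [x]-primitive to which [prim_prim] applies again. *)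
Lemma prim_box_y (a c t y : R) W : mu2.-integrable setT (EFin \o W) ->
  prim c (fun s => box a c W (t, s)) y =
  prim a (fun u => \int[mu]_s (W (u, s) * ramp c y s)) t.
Proof.
move=> Wi.
transitivity (prim c (prim c (fun s => prim a (fun u => W (u, s)) t)) y).
  apply: eq_prim => s _; rewrite -box_swap// boxE//; exact: integrable_swap.
rewrite prim_prim; last exact: (integrable_prim_section a t (integrable_swap Wi)).
rewrite !prim_kernel.
rewrite -(Rfubini_tensor Wi (measurable_stepM _ _) (norm_kernel_le1 _ _)
  (measurable_ramp _ _) (norm_ramp_le _ _)).
rewrite (Rfubini_tensor_swap Wi (measurable_stepM _ _) (norm_kernel_le1 _ _)
  (measurable_ramp _ _) (norm_ramp_le _ _)).
by apply: eq_Rintegral => s _; rewrite -prim_kernel /ramp [RHS]mulrCA [RHS]mulrA.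
Qed.

(** Both sides are the same double integral of [W] against a product of ramps. Passing through it
    avoids linearity of the inner integral, which is at hand only for almost every [t]. *)
Lemma prim_ramp (a c x y : R) W : mu2.-integrable setT (EFin \o W) ->
  prim a (fun t => (x - t) * \int[mu]_s (W (t, s) * ramp c y s)) x =
  prim a (fun t => prim c (fun s => (x - t) * (y - s) * W (t, s)) y) x.
Proof.
move=> Wi.
pose W' w := W w * tensor (ramp a x) (ramp c y) w.
have W'i : mu2.-integrable setT (EFin \o W').
  exact: (integrableM_tensor Wi (measurable_ramp _ _) (norm_ramp_le _ _)
    (measurable_ramp _ _) (norm_ramp_le _ _)).
transitivity (box a c W' (x, y)).
  rewrite prim_kernel /box /=.
  transitivity (\int[mu2]_z W' z).
    rewrite (Rfubini_tensor Wi (measurable_ramp _ _) (norm_ramp_le _ _)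
      (measurable_ramp _ _) (norm_ramp_le _ _)).
    by apply: eq_Rintegral => t _; rewrite /ramp -mulrA mulrCA mulrA.
  apply: eq_Rintegral => z _; rewrite /W' /tensor/= -mulrA; congr (_ * _).
  by rewrite [RHS]mulrACA !ramp_step.
rewrite (boxE a c (x, y) W'i); apply: eq_prim => t tx; apply: eq_prim => s sy.
by rewrite /W' /tensor/= !rampE// mulrC.
Qed.

Lemma box_mixed (a b c d x y C : R) V W p q : rect a b c d (x, y) ->
  mu2.-integrable setT (EFin \o V) -> mu2.-integrable setT (EFin \o W) ->
  mu.-integrable setT (EFin \o p) -> mu.-integrable setT (EFin \o q) ->
  (\forall z \ae mu2, rect a b c d z ->
    V z = C + prim a p z.1 + prim c q z.2 + box a c W z) ->
  box a c V (x, y) =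
  C * (y - c) * (x - a) + (y - c) * prim a (fun t => (x - t) * p t) x
  + (x - a) * prim c (fun s => (y - s) * q s) y
  + prim a (fun t => prim c (fun s => (x - t) * (y - s) * W (t, s)) y) x.
Proof.
move=> [/= xab ycd] Vi Wi pi_ qi VE; rewrite boxE//=.
have [ax xb] : a <= x /\ x <= b by move: xab; rewrite in_itv/= => /andP.
have [cy yd] : c <= y /\ y <= d by move: ycd; rewrite in_itv/= => /andP.
(* The inner [y]-integral with kernel [y - s], left after integrating [box] in [y]. *)
pose H u := \int[mu]_s (W (u, s) * ramp c y s).
have Hi : mu.-integrable setT (EFin \o H).
  exact: (integrable_Rintegral_x (integrableM_snd Wi (measurable_ramp c y) (norm_ramp_le c y))).
have cp := @continuous_prim _ a p pi_; have cH := @continuous_prim _ a H Hi.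
pose B := prim c (fun s => (y - s) * q s) y.
transitivity (prim a (fun t => C * (y - c) + B + ((y - c) * prim a p t + prim a H t)) x).
  apply: (eq_prim_ae xab).
  - exact: (integrableT_measurable (integrable_prim_section c y Vi)).
  - apply: continuous_measurable_fun => t; apply: cvgD; first exact: cvg_cst.
    by apply: cvgD; [apply: cvgM; [exact: cvg_cst|exact: cp]|exact: cH].
  - apply: aeS (aeI (ae_xy VE) (ae_integrable_x Vi)) => t [VEt Vti] tab.
    transitivity (prim c (fun s => C + prim a p t + (prim c q s + box a c W (t, s))) y).
      apply: (eq_prim_ae ycd).
      + exact: (integrableT_measurable Vti).
      + apply: continuous_measurable_fun => s; apply: cvgD; first exact: cvg_cst.
        apply: cvgD; first exact: continuous_prim.
        exact: (continuous_pair_r (continuous_box Wi)).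
      + by apply: aeS VEt => s Vs scd; rewrite Vs//= addrA.
    have cq := @continuous_prim _ c q qi.
    have cW := continuous_pair_r (x := t) (continuous_box (a := a) (c := c) Wi).
    rewrite prim_continuousD; [|by move=> s; exact: cvg_cst|]; last first.
      by move=> s; apply: cvgD; [exact: cq|exact: cW].
    rewrite (prim_cst _ cy) (@prim_continuousD _ c y (prim c q) (fun s => box a c W (t, s)) cq cW) (prim_prim c y qi) prim_box_y// /B /H.
    by rewrite !addrA mulrDl; congr (_ + _); rewrite addrAC [prim a p t * _]mulrC.
rewrite prim_continuousD; [|by move=> t; exact: cvg_cst|]; last first.
  by move=> t; apply: cvgD; [apply: cvgM; [exact: cvg_cst|exact: cp]|exact: cH].
rewrite (prim_cst _ ax).
have cyp : continuous (fun t => (y - c) * prim a p t).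
  by move=> t; apply: cvgM; [exact: cvg_cst|exact: cp].
rewrite (@prim_continuousD _ a x (fun t => (y - c) * prim a p t) (prim a H) cyp cH)
  (@prim_continuousZ _ a x (y - c) (prim a p) cp) (prim_prim a x pi_).
rewrite (prim_prim a x Hi) prim_ramp// -/B.
move: B (prim a _ x) (prim a _ x) => B r1 r2; ring.
Qed.

End iterated_box.

(** * The scalar second-order formula *)

Section second_order.
Context {R : realType}.
Local Notation mu := (@lebesgue_measure R).
Local Notation mu2 := (mu \x mu)%E.
Local Notation mR := (measurableTypeR R).
Implicit Types (p q : R -> R).

Lemma prim_ramp_linear (a b x k : R) p q : x \in `[a, b] -> L2itv a b p -> L2itv a b q ->
  prim a (fun t => (x - t) * p t + k * (x - t) * q t) x =
  prim a (fun t => (x - t) * p t) x + k * prim a (fun t => (x - t) * q t) x.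
Proof.
move=> xab pL qL; have [ax xb] : a <= x /\ x <= b by move: xab; rewrite in_itv/= => /andP.
have rampi f : L2itv a b f ->
    mu.-integrable setT (EFin \o (fun t => (f \_ `[a, b]) t * ramp a x t)).
  move=> /L2itv_integrable fi.
  exact: (@integrableM_bounded R _ mR mu (f \_ `[a, b]) (ramp a x) `|x - a|
    (measurable_ramp a x) (norm_ramp_le a x) fi).
have primE f : prim a (fun t => (x - t) * f t) x = \int[mu]_t ((f \_ `[a, b]) t * ramp a x t).
  rewrite -(prim_patch _ xab) prim_kernel; apply: eq_Rintegral => t _.
  by rewrite !patchE; case: ifP => _; rewrite ?mul0r// /ramp [RHS]mulrCA [RHS]mulrA.
transitivity (\int[mu]_t ((p \_ `[a, b]) t * ramp a x t + k * ((q \_ `[a, b]) t * ramp a x t))).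
  rewrite -(prim_patch _ xab) prim_kernel; apply: eq_Rintegral => t _.
  by rewrite !patchE; case: ifP => _; rewrite ?(mul0r, mulr0, addr0)// /ramp; ring.
rewrite RintegralD//; [|exact: rampi|exact: (integrableZl measurableT k (rampi q qL))].
by rewrite RintegralZl ?primE//; exact: rampi.
Qed.

Lemma prim_ramp_patch (a b x : R) p : x \in `[a, b] ->
  prim a (fun t => (x - t) * (p \_ `[a, b]) t) x = prim a (fun t => (x - t) * p t) x.
Proof.
rewrite in_itv/= => /andP[_ xb]; apply: eq_prim => t /andP[at_ tx].
by rewrite patchE mem_set//= in_itv/= at_ (le_trans tx).
Qed.

(** In the formula for [D 0 0], the traces of [D 1 0] and [D 0 1] are replaced through
    [prim_ae_affine], which creates their corner values and the kernels of the second derivatives;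
    the [box] of [D 1 1] is expanded by [box_mixed]. *)
Lemma second_order_formula (a b c d : R) (D : nat -> nat -> R * R -> R) : a < b -> c < d ->
  (forall i j, (i <= 2)%N -> (j <= 2)%N -> L2rect a b c d (D i j)) ->
  (forall i j, (i <= 2)%N -> (j <= 2)%N ->
    weak_tensor a b c d i j (D 0 0 \_ (rect a b c d)) (D i j \_ (rect a b c d))) ->
  \forall z \ae mu2, rect a b c d z ->
    D 0 0 z = corner_value a b c d (D 0 0) + (z.1 - a) * corner_value a b c d (D 1 0)
      + (z.2 - c) * corner_value a b c d (D 0 1)
      + (z.2 - c) * (z.1 - a) * corner_value a b c d (D 1 1)
      + prim a (fun t => (z.1 - t) * trace_y a b c d (D 2 0) t
          + (z.2 - c) * (z.1 - t) * trace_y a b c d (D 2 1) t) z.1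
      + prim c (fun s => (z.2 - s) * trace_x a b c d (D 0 2) s
          + (z.1 - a) * (z.2 - s) * trace_x a b c d (D 1 2) s) z.2
      + prim a (fun t => prim c (fun s => (z.1 - t) * (z.2 - s) * D 2 2 (t, s)) z.2) z.1.
Proof.
move=> ab cd DL wD.
(* The hypotheses relate every entry to [D 0 0] only; [mixed_formula] needs relations between
   neighbouring entries. *)
have wDD i j k l : (i + k <= 2)%N -> (j + l <= 2)%N ->
    weak_tensor a b c d k l (D i j \_ (rect a b c d)) (D (i + k) (j + l) \_ (rect a b c d)).
  move=> ik jl; apply: weak_tensor_sub (wD _ _ _ _) (wD _ _ ik jl).
  - exact: leq_trans (leq_addr k i) ik.
  - exact: leq_trans (leq_addr l j) jl.
have [P00 Q00 E00 _ _] := mixed_formula ab cd (DL 0 0 isT isT) (DL 1 0 isT isT)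
  (DL 0 1 isT isT) (DL 1 1 isT isT) (wDD 0 0 1 0 isT isT) (wDD 0 0 0 1 isT isT)
  (wDD 1 0 0 1 isT isT) (wDD 0 1 1 0 isT isT).
have [P10 _ _ T10 _] := mixed_formula ab cd (DL 1 0 isT isT) (DL 2 0 isT isT)
  (DL 1 1 isT isT) (DL 2 1 isT isT) (wDD 1 0 1 0 isT isT) (wDD 1 0 0 1 isT isT)
  (wDD 2 0 0 1 isT isT) (wDD 1 1 1 0 isT isT).
have [_ Q01 _ _ T01] := mixed_formula ab cd (DL 0 1 isT isT) (DL 1 1 isT isT)
  (DL 0 2 isT isT) (DL 1 2 isT isT) (wDD 0 1 1 0 isT isT) (wDD 0 1 0 1 isT isT)
  (wDD 1 1 0 1 isT isT) (wDD 0 2 1 0 isT isT).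
have [P11 Q11 E11 _ _] := mixed_formula ab cd (DL 1 1 isT isT) (DL 2 1 isT isT)
  (DL 1 2 isT isT) (DL 2 2 isT isT) (wDD 1 1 1 0 isT isT) (wDD 1 1 0 1 isT isT)
  (wDD 2 1 0 1 isT isT) (wDD 1 2 1 0 isT isT).
(* Cut to the rectangle and the intervals, the functions are integrable on the plane and the line,
   as [box_mixed] asks; primitives at points of the rectangle ignore the cut. *)
have {}E11 : \forall z \ae mu2, rect a b c d z -> (D 1 1 \_ (rect a b c d)) z =
    corner_value a b c d (D 1 1) + prim a (trace_y a b c d (D 2 1) \_ `[a, b]) z.1
    + prim c (trace_x a b c d (D 1 2) \_ `[c, d]) z.2
    + box a c (D 2 2 \_ (rect a b c d)) z.
  by apply: aeS E11 => z Dz rz; have [/= xab ycd] := rz;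
    rewrite patchE mem_set// Dz// !prim_patch.
apply: aeS E00 => -[x y] E00 rz; have [/= xab ycd] := rz.
have boxE2 := box_mixed rz (L2rect_integrable (DL 1 1 isT isT)) (L2rect_integrable (DL 2 2 isT isT))
  (L2itv_integrable P11) (L2itv_integrable Q11) E11.
rewrite (E00 rz) (prim_ae_affine xab P00 P10 T10) (prim_ae_affine ycd Q00 Q01 T01) boxE2 (prim_ramp_patch _ xab) (prim_ramp_patch _ ycd) (prim_ramp_linear _ xab P10 P11) (prim_ramp_linear _ ycd Q01 Q11).
have -> : prim a (fun t => prim c (fun s =>
      (x - t) * (y - s) * (D 2 2 \_ (rect a b c d)) (t, s)) y) x =
    prim a (fun t => prim c (fun s => (x - t) * (y - s) * D 2 2 (t, s)) y) x.
  apply: eq_prim => t /andP[at_ tx]; apply: eq_prim => s /andP[cs sy].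
  rewrite patchE mem_set//; move: xab ycd; rewrite !in_itv/= => /andP[_ xb] /andP[_ yd].
  by split; rewrite /= in_itv/= ?at_ ?cs ?(le_trans tx) ?(le_trans sy).
move: (corner_value _ _ _ _ (D 0 0)) (corner_value _ _ _ _ (D 1 0))
  (corner_value _ _ _ _ (D 0 1)) (corner_value _ _ _ _ (D 1 1))
  (prim a (fun t => (x - t) * trace_y a b c d (D 2 0) t) x)
  (prim a (fun t => (x - t) * trace_y a b c d (D 2 1) t) x)
  (prim c (fun s => (y - s) * trace_x a b c d (D 0 2) s) y)
  (prim c (fun s => (y - s) * trace_x a b c d (D 1 2) s) y)
  (prim a (fun t => prim c _ y) x) => C00 C10 C01 C11 p1 p2 q1 q2 w /=.
ring.
Qed.

End second_order.

(** * From scalar components to block vectors and kernel matrices *)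

Section blocks.
Context {R : realType}.
Local Notation mu := (@lebesgue_measure R).
Local Notation mu2 := (mu \x mu)%E.
Implicit Types (a b c d : R).

Lemma Hspace_wderiv a b c d k i j (f : R * R -> R) : Hspace a b c d k f ->
  (i <= k)%N -> (j <= k)%N ->
  L2rect a b c d (wderiv a b c d i j f) /\
  weak_tensor a b c d i j (f \_ (rect a b c d)) (wderiv a b c d i j f \_ (rect a b c d)).
Proof.
move=> [_ Hf] ik jk; have [|g gL fg] := Hf i j; first by rewrite geq_max ik jk.
by have /= [wL wf] := xgetPex (fun=> 0 : R) (ex_intro (fun h => L2rect a b c d h /\
  is_weak_deriv a b c d i j f h) g (conj gL fg)); split=> //; exact: is_weak_deriv_tensor.
Qed.

Lemma Hspace1_formula a b c d (f : R * R -> R) : a < b -> c < d ->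
  Hspace a b c d 1 f ->
  \forall z \ae mu2, rect a b c d z ->
    f z = corner_value a b c d f
      + prim a (trace_y a b c d (wderiv a b c d 1 0 f)) z.1
      + prim c (trace_x a b c d (wderiv a b c d 0 1 f)) z.2
      + prim a (fun t => prim c (fun s => wderiv a b c d 1 1 f (t, s)) z.2) z.1.
Proof.
move=> ab cd Hf.
have [L10 w10] := Hspace_wderiv (i := 1) (j := 0) Hf isT isT.
have [L01 w01] := Hspace_wderiv (i := 0) (j := 1) Hf isT isT.
have [L11 w11] := Hspace_wderiv (i := 1) (j := 1) Hf isT isT.
have [_ _ fE _ _] := mixed_formula ab cd Hf.1 L10 L01 L11 w10 w01
  (weak_tensor_sub (k := 0) (l := 1) w10 w11) (weak_tensor_sub (k := 1) (l := 0) w01 w11).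
apply: aeS fE => -[x y] fE rz; rewrite (fE rz); congr (_ + _).
rewrite (boxE _ _ _ (L2rect_integrable L11)); apply: eq_prim => t /andP[at_ tx].
apply: eq_prim => s /andP[cs sy]; have [] := rz; rewrite /= !in_itv/= => /andP[_ xb] /andP[_ yd].
rewrite patchE mem_set//.
by split; rewrite /= in_itv/= ?at_ ?cs ?(le_trans tx) ?(le_trans sy).
Qed.

Lemma Hspace2_formula a b c d (f : R * R -> R) : a < b -> c < d ->
  Hspace a b c d 2 f ->
  \forall z \ae mu2, rect a b c d z ->
    f z = corner_value a b c d f
      + (z.1 - a) * corner_value a b c d (wderiv a b c d 1 0 f)
      + (z.2 - c) * corner_value a b c d (wderiv a b c d 0 1 f)
      + (z.2 - c) * (z.1 - a) * corner_value a b c d (wderiv a b c d 1 1 f)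
      + prim a (fun t => (z.1 - t) * trace_y a b c d (wderiv a b c d 2 0 f) t
          + (z.2 - c) * (z.1 - t) * trace_y a b c d (wderiv a b c d 2 1 f) t) z.1
      + prim c (fun s => (z.2 - s) * trace_x a b c d (wderiv a b c d 0 2 f) s
          + (z.1 - a) * (z.2 - s) * trace_x a b c d (wderiv a b c d 1 2 f) s) z.2
      + prim a (fun t => prim c (fun s =>
          (z.1 - t) * (z.2 - s) * wderiv a b c d 2 2 f (t, s)) z.2) z.1.
Proof.
move=> ab cd Hf.
(* The entry of order (0,0) is [f] itself, since [wderiv] of order (0,0) is only some representative
   of it. *)
pose D i j := if (i + j == 0)%N then f else wderiv a b c d i j f.
apply: (@second_order_formula R a b c d D ab cd) => -[|i] [|j] i2 j2.
- exact: Hf.1.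
- exact: (Hspace_wderiv Hf i2 j2).1.
- exact: (Hspace_wderiv Hf i2 j2).1.
- exact: (Hspace_wderiv Hf i2 j2).1.
- by move=> phi psi _ _; rewrite mul1r.
- exact: (Hspace_wderiv Hf i2 j2).2.
- exact: (Hspace_wderiv Hf i2 j2).2.
- exact: (Hspace_wderiv Hf i2 j2).2.
Qed.

Lemma wderivvE a b c d i j m (f : R * R -> 'cV[R]_m) l :
  (fun z => wderivv a b c d i j f z l 0) = wderiv a b c d i j (fun z => f z l 0).
Proof. by apply/funext => z; rewrite mxE. Qed.

Lemma corner_valuevE a b c d m (f : R * R -> 'cV[R]_m) l :
  corner_valuev a b c d f l 0 = corner_value a b c d (fun z => f z l 0).
Proof. exact: mxE. Qed.

Lemma trace_yvE a b c d m (f : R * R -> 'cV[R]_m) x l :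
  trace_yv a b c d f x l 0 = trace_y a b c d (fun z => f z l 0) x.
Proof. exact: mxE. Qed.

Lemma trace_xvE a b c d m (f : R * R -> 'cV[R]_m) y l :
  trace_xv a b c d f y l 0 = trace_x a b c d (fun z => f z l 0) y.
Proof. exact: mxE. Qed.

Lemma intvE m (s t : R) (F : R -> 'cV[R]_m) l :
  intv s t F l 0 = prim s (fun x => F x l 0) t.
Proof. exact: mxE. Qed.

Lemma col_linear4 m (v1 v2 v3 v4 : 'cV[R]_m) l :
  (v1 + v2 + v3 + v4) l 0 = v1 l 0 + v2 l 0 + v3 l 0 + v4 l 0.
Proof. by rewrite !mxE. Qed.

Lemma col_linear2 m (k1 k2 : R) (v1 v2 : 'cV[R]_m) l :
  (k1 *: v1 + k2 *: v2) l 0 = k1 * v1 l 0 + k2 * v2 l 0.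
Proof. by rewrite !mxE. Qed.

Lemma col_linear7 m (k2 k3 k4 : R) (v1 v2 v3 v4 v5 v6 v7 : 'cV[R]_m) l :
  (v1 + k2 *: v2 + k3 *: v3 + k4 *: v4 + v5 + v6 + v7) l 0 =
  v1 l 0 + k2 * v2 l 0 + k3 * v3 l 0 + k4 * v4 l 0 + v5 l 0 + v6 l 0 + v7 l 0.
Proof. by rewrite !mxE. Qed.

Lemma intv_col_mx (s t : R) m n (F : R -> 'cV[R]_m) (G : R -> 'cV[R]_n) :
  intv s t (fun x => col_mx (F x) (G x)) = col_mx (intv s t F) (intv s t G).
Proof.
apply/colP => l; rewrite !mxE.
by case: split_ordP => k ->; rewrite !mxE; apply: eq_Rintegral => x _;
  rewrite ?col_mxEu ?col_mxEd.
Qed.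

Lemma intv0 (s t : R) m : intv s t (fun=> 0 : 'cV[R]_m) = 0.
Proof. by apply/colP => l; rewrite !mxE Rintegral_eq0// => x _; rewrite mxE. Qed.

Lemma ae_forall_fin disp (T : measurableType disp) (nu : {measure set T -> \bar R})
    (I : finType) (P : I -> T -> Prop) :
  (forall i, \forall z \ae nu, P i z) -> \forall z \ae nu, forall i, P i z.
Proof. exact: filter_forall. Qed.

Lemma Hspacev1_formula a b c d m (f : R * R -> 'cV[R]_m) : a < b -> c < d ->
  Hspacev a b c d 1 f ->
  \forall z \ae mu2, rect a b c d z ->
    f z = corner_valuev a b c d f
      + intv a z.1 (trace_yv a b c d (wderivv a b c d 1 0 f))
      + intv c z.2 (trace_xv a b c d (wderivv a b c d 0 1 f))
      + intv a z.1 (fun t => intv c z.2 (fun s => wderivv a b c d 1 1 f (t, s))).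
Proof.
move=> ab cd Hf; have fE := ae_forall_fin (fun l => Hspace1_formula ab cd (Hf l)).
apply: aeS fE => z fE rz; apply/colP => l.
rewrite (fE l rz) col_linear4 corner_valuevE; congr (_ + _ + _ + _); rewrite intvE; congr prim;
  apply/funext => t.
- by rewrite trace_yvE wderivvE.
- by rewrite trace_xvE wderivvE.
- by rewrite intvE; congr prim; apply/funext => s; rewrite -wderivvE.
Qed.

Lemma Hspacev2_formula a b c d m (f : R * R -> 'cV[R]_m) : a < b -> c < d ->
  Hspacev a b c d 2 f ->
  \forall z \ae mu2, rect a b c d z ->
    f z = corner_valuev a b c d f
      + (z.1 - a) *: corner_valuev a b c d (wderivv a b c d 1 0 f)
      + (z.2 - c) *: corner_valuev a b c d (wderivv a b c d 0 1 f)
      + ((z.2 - c) * (z.1 - a)) *: corner_valuev a b c d (wderivv a b c d 1 1 f)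
      + intv a z.1 (fun t => (z.1 - t) *: trace_yv a b c d (wderivv a b c d 2 0 f) t
          + ((z.2 - c) * (z.1 - t)) *: trace_yv a b c d (wderivv a b c d 2 1 f) t)
      + intv c z.2 (fun s => (z.2 - s) *: trace_xv a b c d (wderivv a b c d 0 2 f) s
          + ((z.1 - a) * (z.2 - s)) *: trace_xv a b c d (wderivv a b c d 1 2 f) s)
      + intv a z.1 (fun t => intv c z.2 (fun s =>
          ((z.1 - t) * (z.2 - s)) *: wderivv a b c d 2 2 f (t, s))).
Proof.
move=> ab cd Hf; have fE := ae_forall_fin (fun l => Hspace2_formula ab cd (Hf l)).
apply: aeS fE => z fE rz; apply/colP => l.
rewrite (fE l rz) col_linear7; congr (_ + _ * _ + _ * _ + _ * _ + _ + _ + _).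
- by rewrite corner_valuevE.
- by rewrite corner_valuevE wderivvE.
- by rewrite corner_valuevE wderivvE.
- by rewrite corner_valuevE wderivvE.
- by rewrite intvE; congr prim; apply/funext => t; rewrite col_linear2;
    congr (_ * _ + _ * _); rewrite trace_yvE wderivvE.
- by rewrite intvE; congr prim; apply/funext => s; rewrite col_linear2;
    congr (_ * _ + _ * _); rewrite trace_xvE wderivvE.
- rewrite intvE; congr prim; apply/funext => t; rewrite intvE; congr prim; apply/funext => s.
  by rewrite [RHS]mxE -wderivvE.
Qed.

Lemma K30_mul n0 n1 n2 a c x y (p1 : 'cV[R]_n1) (p2 p3 p4 p5 : 'cV[R]_n2) :
  K30 a c n0 n1 n2 x y *m col_mx p1 (col_mx p2 (col_mx p3 (col_mx p4 p5))) =
  col_mx 0 (col_mx p1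
    (p2 + (x - a) *: p3 + (y - c) *: p4 + ((y - c) * (x - a)) *: p5)).
Proof.
by rewrite /K30 !mul_col_mx !mul_row_col !mul0mx !mul1mx !mul_scalar_mx addr0 add0r !addrA.
Qed.

Lemma intv_K31 n0 n1 n2 a c x y (q1 : R -> 'cV[R]_n1) (q2 q3 : R -> 'cV[R]_n2) :
  intv a x (fun t => K31 c n0 n1 n2 x y t *m col_mx (q1 t) (col_mx (q2 t) (q3 t))) =
  col_mx 0 (col_mx (intv a x q1)
    (intv a x (fun t => (x - t) *: q2 t + ((y - c) * (x - t)) *: q3 t))).
Proof.
(* The zero block becomes an integral of 0, so that all three blocks are collected under one
   [intv]. *)
rewrite -[0 in RHS](intv0 a x) -!intv_col_mx; congr intv; apply/funext => t.
by rewrite /K31 !mul_col_mx !mul_row_col !mul0mx !mul1mx !mul_scalar_mx addr0 add0r.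
Qed.

Lemma intv_K32 n0 n1 n2 a c x y (q1 : R -> 'cV[R]_n1) (q2 q3 : R -> 'cV[R]_n2) :
  intv c y (fun s => K32 a n0 n1 n2 x y s *m col_mx (q1 s) (col_mx (q2 s) (q3 s))) =
  col_mx 0 (col_mx (intv c y q1)
    (intv c y (fun s => (y - s) *: q2 s + ((x - a) * (y - s)) *: q3 s))).
Proof.
rewrite -[0 in RHS](intv0 c y) -!intv_col_mx; congr intv; apply/funext => s.
by rewrite /K32 !mul_col_mx !mul_row_col !mul0mx !mul1mx !mul_scalar_mx addr0 add0r.
Qed.

Lemma intv_K33 n0 n1 n2 a c x y (w0 : R * R -> 'cV[R]_n0)
    (w1 : R * R -> 'cV[R]_n1) (w2 : R * R -> 'cV[R]_n2) :
  intv a x (fun t => intv c y (fun s =>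
    K33 n0 n1 n2 x y t s *m col_mx (w0 (t, s)) (col_mx (w1 (t, s)) (w2 (t, s))))) =
  col_mx 0 (col_mx (intv a x (fun t => intv c y (fun s => w1 (t, s))))
    (intv a x (fun t => intv c y (fun s => ((x - t) * (y - s)) *: w2 (t, s))))).
Proof.
rewrite -[0 in RHS](intv0 a x) -!intv_col_mx; congr intv; apply/funext => t.
rewrite -[0 in RHS](intv0 c y) -!intv_col_mx; congr intv; apply/funext => s.
by rewrite /K33 !mul_block_col !mul0mx !mul1mx !mul_scalar_mx !addr0 !add0r.
Qed.

Lemma T00_mul n0 n1 n2 (w0 : 'cV[R]_n0) (w1 : 'cV[R]_n1) (w2 : 'cV[R]_n2) :
  T00 n0 n1 n2 *m col_mx w0 (col_mx w1 w2) = col_mx w0 0.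
Proof. by rewrite /T00 mul_block_col !mul0mx mul1mx !addr0. Qed.

End blocks.

Theorem lemma10 (R : realType) (n0 n1 n2 : nat) (a b c d : R)
    (hab : a < b) (hcd : c < d)
    (u : R * R -> 'cV[R]_(n0 + (n1 + n2)))
    (hu0 : L2rectv a b c d (blk0 u))
    (hu1 : Hspacev a b c d 1 (blk1 u))
    (hu2 : Hspacev a b c d 2 (blk2 u)) :
  u = K1op a c (Lambda_bc a b c d u) \+ K2op a c (Dop a b c d u)
    %[ae leb2 in rect a b c d].
Proof.
apply: aeS (aeI (Hspacev1_formula hab hcd hu1) (Hspacev2_formula hab hcd hu2)).
move=> -[x y] [E1 E2] rz.
have -> : u (x, y) = col_mx (blk0 u (x, y)) (col_mx (blk1 u (x, y)) (blk2 u (x, y))).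
  by rewrite !vsubmxK.
rewrite (E1 rz) (E2 rz) /K1op /K2op /Lambda_bc /Dop /= K30_mul T00_mul intv_K31 intv_K32.
rewrite (intv_K33 a c x y (blk0 u) (wderivv a b c d 1 1 (blk1 u))
  (wderivv a b c d 2 2 (blk2 u))).
(* The zero block left by [T00] has height [n1 + n2]; it is split in two so that the columns add
   block by block. *)
by rewrite -[X in _ + (col_mx _ X + _)]col_mx0 !add_col_mx !(add0r, addr0).
Qed.
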